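(* Let $S\cong\mathfrak{v}\times\mathfrak{z}\times\mathbb{R}_+$ be the Damek-Ricci space obtained as the one-dimensional extension of the generalized Heisenberg group $N=\exp(\mathfrak{v}\oplus\mathfrak{z})$, with $k=\dim\mathfrak{v}$, $m=\dim\mathfrak{z}$, and let $\partial S\cong N\cup\{\infty\}$ be its ideal boundary. For $\theta\in\partial S$ let $b_\theta$ be the Busemann function on $S$ determined by $\theta$, and let $H_\theta=\nabla db_\theta$ be its Hessian, regarded as a symmetric endomorphism of each tangent space $T_pS$ by means of the metric. (1) When $\theta=\infty$, at every point $p\in S$ the endomorphism $H_\theta$ has eigenvalues $0,\frac12,1$ with multiplicities $1,k,m$, respectively. (2) Let $\theta=(v,z)\neq\infty$ and $p=(V,Z,a)\in S$, and put $\mathcal{V}=v-V\in\mathfrak{v}$, $\mathcal{Z}=z-Z-\frac12[V,v]_{\mathfrak n}\in\mathfrak{z}$ and $F=\left(a+\frac14|\mathcal{V}|^2\right)^2+|\mathcal{Z}|^2$. (2-i) If $\mathcal{V}=0$ or $\mathcal{Z}=0$, then $H_\theta$ has eigenvalues $0,\frac12,1$ at $p$ with multiplicities $1,k,m$, respectively. (2-ii) If $\mathcal{V}\neq0$ and $\mathcal{Z}\neq0$, let $\mathfrak{s}_4\subset T_pS$ be the subspace spanned by $\{\mathcal{V},J_{\mathcal{Z}}\mathcal{V},\mathcal{Z},A\}$, and let $\mathfrak{s}_4^{\perp}$ be its orthogonal complement in $T_pS$. Then: (2-ii-a) the restriction $H_\theta|_{\mathfrak{s}_4}$ has eigenvalues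 $0,\frac12,1$ at $p$ with multiplicities $1,2,1$, respectively; (2-ii-b) the eigenvalues $\lambda$ of $H_\theta|_{\mathfrak{s}_4^\perp}$ are solutions of the cubic equation $$\left(\lambda-\frac12\right)^2(\lambda-1)=-(\mu+1)\frac{a^2|\mathcal{V}|^4|\mathcal{Z}|^2}{8F^3},$$ where $\mu$ is an eigenvalue of the symmetric operator $K^2$, with $K=K_{\mathcal{V}/|\mathcal{V}|,\,\mathcal{Z}/|\mathcal{Z}|}$; and these eigenvalues $\lambda$ are all positive.
   Context: Generalized Heisenberg algebra: $\mathfrak{n}$ is a 2-step nilpotent Lie algebra with bracket $[\cdot,\cdot]_{\mathfrak n}$ and inner product $\langle\cdot,\cdot\rangle_{\mathfrak n}$, $\mathfrak{z}$ is its center, $\mathfrak{v}=\mathfrak{z}^\perp$; for $Z\in\mathfrak{z}$ the skew-symmetric map $J_Z:\mathfrak{v}\to\mathfrak{v}$ is defined by $\langle J_ZV_1,V_2\rangle_{\mathfrak n}=\langle Z,[V_1,V_2]_{\mathfrak n}\rangle_{\mathfrak n}$, and it is required that $J_Z^2=-|Z|^2\mathrm{id}_{\mathfrak v}$ for all $Z\in\mathfrak{z}$. $N$ is the simply connected Lie group of $\mathfrak{n}$, identified with $\mathfrak{v}\times\mathfrak{z}$ via the exponential map. Damek-Ricci space: $\mathfrak{s}=\mathfrak{v}\oplus\mathfrak{z}\oplus\mathbb{R}A$ with bracket $[U_1+Y_1+s_1A,U_2+Y_2+s_2A]_{\mathfrak s}=\frac{s_1}{2}U_2-\frac{s_2}{2}U_1+s_1Y_2-s_2Y_1+[U_1,U_2]_{\mathfrak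 n}$ and inner product $\langle U_1+Y_1+s_1A,U_2+Y_2+s_2A\rangle_{\mathfrak s}=\langle U_1,U_2\rangle_{\mathfrak n}+\langle Y_1,Y_2\rangle_{\mathfrak n}+s_1s_2$ ($U_i\in\mathfrak v$, $Y_i\in\mathfrak z$, $s_i\in\mathbb R$). $S$ is the simply connected Lie group with Lie algebra $\mathfrak{s}$ and the induced left-invariant metric $g$. It is identified with $\mathfrak{v}\times\mathfrak{z}\times\mathbb{R}_+$ with group law $(V_1,Z_1,a_1)(V_2,Z_2,a_2)=\left(V_1+\sqrt{a_1}V_2,\ Z_1+a_1Z_2+\frac{\sqrt{a_1}}{2}[V_1,V_2]_{\mathfrak n},\ a_1a_2\right)$, the coordinate of $sA$ being $a=e^s$. Each $T_pS$ is identified with $\mathfrak{s}$ by left translation; this is how elements of $\mathfrak v$, $\mathfrak z$ and $A$ are regarded as tangent vectors at $p$. Busemann functions: $S$ is a Hadamard manifold, and for a unit speed geodesic $\gamma$, $b_\gamma(x)=\lim_{t\to\infty}(d(\gamma(t),x)-t)$. Asymptotic geodesic rays (those at bounded distance) give Busemann functions differing by constants, so the Hessian depends only on the point $\theta\in\partial S$ (the ideal boundary is the set of classes of asymptotic rays). With the identification $\partial S\cong N\cup\{\infty\}$, $N\simeq\mathfrak{v}\times\mathfrak{z}$, and normalization at the identity $(0,0,1)$, the Busemann function at $p=(V,Z,a)$ is $$b_\theta(p)=\log\frac{\left(a+\frac14|v-V|^2\right)^2+\left|z-Z-\frac12[V,v]_{\mathfrak n}\right|^2}{a\left(\left(1+\frac14|v|^2\right)^2+|z|^2\right)}\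 \text{ if }\theta=(v,z),\qquad b_\infty(p)=-\log a .$$ The operator $K$: for unit vectors $V\in\mathfrak{v}$, $Z\in\mathfrak{z}$, let $Z^\perp=\{Y\in\mathfrak{z}:\langle Z,Y\rangle_{\mathfrak n}=0\}$ and define $K_{V,Z}:Z^\perp\to Z^\perp$ by $K_{V,Z}(X)=[V,J_XJ_ZV]_{\mathfrak n}$. It is skew-symmetric, so $K_{V,Z}^2$ is symmetric.
   Formalization: In (2-ii-b) an eigenvalue λ=1/2 is exempted from the cubic when some nonzero U in 𝔳 is orthogonal to all J_X𝒱 and J_XJ_𝒵𝒱, X∈𝔷; as written the claim fails, e.g. for m=1, k≥4, where 𝒵^⊥=0, K² has no eigenvalue, yet H=1/2 on 𝔰₄^⊥≠0. *)

(* Defs.v *)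
From HB Require Import structures.
From mathcomp Require Import all_boot all_order all_algebra sesquilinear.
From mathcomp Require Import all_classical all_reals all_analysis.
Import Order.TTheory GRing.Theory Num.Theory.
Import numFieldNormedType.Exports.

Set Implicit Arguments.
Unset Strict Implicit.
Unset Printing Implicit Defensive.

Local Open Scope classical_set_scope.
Local Open Scope ring_scope.

(* The Jacobi identity is a consequence of lie_nil. *)
Record metricLie2 (R : realType) (n : vectType R) := MetricLie2 {
  lie : {bilinear n -> n -> n};
  dotn : {dot n for idfun};
  lie_alt : forall x, lie x x = 0;
  lie_nil : forall x y w, lie (lie x y) w = 0;
  lie_neq0 : exists x y, lie x y != 0 }.

Section Nilpotent.
Variables (R : realType) (n : vectType R) (G : metricLie2 n).

Definition lie_ad (x : n) : 'End(n) := linfun (lie G x).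

Lemma lie_ad_linear : linear lie_ad.
Proof.
move=> a u v; apply/lfunP => y.
by rewrite lfunE /= linearPl add_lfunE scale_lfunE /lie_ad !lfunE.
Qed.

HB.instance Definition _ := GRing.isLinear.Build R n 'End(n) *:%R lie_ad
  lie_ad_linear.

(* z is the center of n, i.e. the kernel of ad (see mem_zspaceP). *)
Definition zspace : {vspace n} := lker (linfun lie_ad).

Lemma mem_zspaceP x : reflect (forall y, lie G x y = 0) (x \in zspace).
Proof.
rewrite memv_ker lfunE /=.
apply: (iffP eqP) => [E y|E].
  by rewrite -[LHS]/(_ y) -(lfunE (lie G x)) -/(lie_ad x) E lfunE.
by apply/lfunP => y; rewrite !lfunE /= E.
Qed.

Definition vspc : {vspace n} := orthov (dotn G) zspace.

Definition zT := subvs_of zspace.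
Definition vT := subvs_of vspc.

Definition dotv (V1 V2 : vT) : R := dotn G (vsval V1) (vsval V2).
Definition dotz (Z1 Z2 : zT) : R := dotn G (vsval Z1) (vsval Z2).
Definition normv (V : vT) : R := Num.sqrt (dotv V V).
Definition normz (Z : zT) : R := Num.sqrt (dotz Z Z).

(* Brackets are central, so vsproj does not change them (see vsval_brvz). *)
Definition brvz (V1 V2 : vT) : zT :=
  vsproj zspace (lie G (vsval V1) (vsval V2)).

Lemma vsval_brvz V1 V2 : vsval (brvz V1 V2) = lie G (vsval V1) (vsval V2).
Proof. by rewrite vsprojK //; apply/mem_zspaceP => y; apply: lie_nil. Qed.

(* The first clause determines J. *)
Definition generalized_heisenberg (J : zT -> vT -> vT) : Prop :=
  (forall Z V1 V2, dotv (J Z V1) V2 = dotz Z (brvz V1 V2)) /\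
  (forall Z V, J Z (J Z V) = - (normz Z ^+ 2) *: V).

Record damek_ricci := DamekRicci { cV : vT; cZ : zT; ca : {posnum R} }.

Definition mulS (p q : damek_ricci) : damek_ricci :=
  DamekRicci (cV p + Num.sqrt (ca p)%:num *: cV q)
        (cZ p + (ca p)%:num *: cZ q
          + (Num.sqrt (ca p)%:num / 2) *: brvz (cV p) (cV q))
        ((ca p)%:num * (ca q)%:num)%:pos.

Definition oneS : damek_ricci := DamekRicci 0 0 1%:pos.

(* s = v + z + R A, with U + Y + s A encoded as (U, Y, s). *)
Definition sT := (vT * zT * R^o)%type.

Definition vpart (X : sT) : vT := X.1.1.
Definition zpart (X : sT) : zT := X.1.2.
Definition apart (X : sT) : R := X.2.

Definition inV (U : vT) : sT := (U, 0, 0).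
Definition inZ (Y : zT) : sT := (0, Y, 0).
Definition vecA : sT := (0, 0, 1).

Definition brs (X1 X2 : sT) : sT :=
  ((apart X1 / 2) *: vpart X2 - (apart X2 / 2) *: vpart X1,
   apart X1 *: zpart X2 - apart X2 *: zpart X1 + brvz (vpart X1) (vpart X2),
   0).

Definition dots (X1 X2 : sT) : R :=
  dotv (vpart X1) (vpart X2) + dotz (zpart X1) (zpart X2)
  + apart X1 * apart X2.

Lemma dots_linearl Y : linear_for *%R (dots ^~ Y).
Proof.
move=> a u v; rewrite /dots.
have -> : apart (a *: u + v) = a * apart u + apart v by [].
have -> W : dotv (vpart (a *: u + v)) W = a * dotv (vpart u) W + dotv (vpart v) W.
  exact: linearPl.
have -> W : dotz (zpart (a *: u + v)) W = a * dotz (zpart u) W + dotz (zpart v) W.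
  exact: linearPl.
rewrite mulrDl -mulrA ![a * (_ + _)]mulrDr.
by rewrite (addrACA (a * dotv _ _)) [LHS]addrACA.
Qed.

Lemma dots_herm X Y : dots X Y = (-1) ^+ false * idfun (dots Y X).
Proof.
rewrite expr0 mul1r /dots /dotv /dotz hermC expr0 mul1r.
rewrite [dotn G (vsval (zpart X)) _]hermC expr0 mul1r.
by rewrite [apart X * _]mulrC.
Qed.

Lemma dots_bilinear : bilinear_for *%R (idfun \; *%R) dots.
Proof.
split; first exact: dots_linearl.
move=> X a u v; rewrite ![dots X _]dots_herm !expr0 !mul1r /=.
exact: dots_linearl.
Qed.

HB.instance Definition _ := bilinear_isBilinear.Build R sT sT R
  *%R (idfun \; *%R) dots dots_bilinear.

HB.instance Definition _ := isHermitianSesquilinear.Build R sT false idfun dots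
  dots_herm.

Lemma dotn_ge0 x : 0 <= dotn G x x.
Proof.
by have [->|/neq0_dnorm_gt0/ltW //] := eqVneq x 0; rewrite linear0l.
Qed.

Lemma dots_gt0 X : X != 0 -> 0 < dots X X.
Proof.
apply: contraNT; rewrite -leNgt /dots /dotv /dotz => le0.
have ge0 : forall x, 0 <= dotn G x x := dotn_ge0.
have dotn0 x : dotn G x x <= 0 -> x = 0.
  by move=> xle0; apply/eqP; apply: contraTT xle0 => /neq0_dnorm_gt0; rewrite -ltNge.
have sq0 : 0 <= apart X * apart X by rewrite -expr2 sqr_ge0.
have V0 : vpart X = 0.
  apply/val_inj/dotn0/(le_trans _ le0).
  by rewrite -addrA lerDl addr_ge0.
have Z0 : zpart X = 0.
  apply/val_inj/dotn0/(le_trans _ le0).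
  by rewrite addrAC lerDr addr_ge0.
have A0 : apart X = 0.
  apply/eqP; rewrite -sqrf_eq0 expr2 eq_le sq0 andbT.
  by apply: le_trans le0; rewrite lerDr addr_ge0.
by case: X {le0 sq0} V0 Z0 A0 => -[U Y] s; rewrite /vpart /zpart /apart /= => -> -> ->.
Qed.

HB.instance Definition _ := isDotProduct.Build R sT dots dots_gt0.

(* Torsion-freeness and compatibility with the metric on left-invariant      *)
(* vector fields; by the Koszul formula they determine nabla.                 *)
Definition levi_civita (nabla : sT -> sT -> sT) : Prop :=
  (forall X Y, nabla X Y - nabla Y X = brs X Y) /\
  (forall X Y W, dots (nabla X Y) W + dots Y (nabla X W) = 0).

Definition expRp (x : R) : {posnum R} := PosNum (expR_gt0 x).

(* A curve of S with velocity X at t = 0, once left-translated to p. *)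
Definition lmove (X : sT) (p : damek_ricci) (t : R) : damek_ricci :=
  mulS p (DamekRicci (t *: vpart X) (t *: zpart X) (expRp (t * apart X))).

(* Action of the left-invariant vector field X on functions. *)
Definition lderiv (X : sT) (f : damek_ricci -> R) (p : damek_ricci) : R :=
  derive1 (fun t : R => f (lmove X p t) : R) 0.

(* H is the endomorphism of T_pS = s metrically equivalent to the bilinear    *)
(* form (nabla df)(X, Y) = X (Y f) - (nabla_X Y) f at p.                      *)
Definition is_hessian (f : damek_ricci -> R) (p : damek_ricci) (H : 'End(sT)) : Prop :=
  exists nabla : sT -> sT -> sT,
  [/\ levi_civita nabla,
      forall X q, derivable (fun t : R => f (lmove X q t)) 0 1,
      forall X Y, derivable (fun t : R => lderiv Y f (lmove X p t)) 0 1 &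
      forall X Y, dots (H X) Y =
                  lderiv X (lderiv Y f) p - lderiv (nabla X Y) f p].

(* c is a C^1 curve in S whose velocity at time t is the left translate to    *)
(* c t of X t.  Derivatives and continuity of vector-valued maps are tested   *)
(* on linear forms; the vectors on the right are the components of the        *)
(* differential at the identity of the left translation by c t, applied to    *)
(* X t.                                                                       *)
Definition C1_curve (c : R -> damek_ricci) (X : R -> sT) : Prop :=
  [/\ forall W (t : R), is_derive t 1 (fun u : R => dotv W (cV (c u)))
        (dotv W (Num.sqrt (ca (c t))%:num *: vpart (X t))),
      forall W (t : R), is_derive t 1 (fun u : R => dotz W (cZ (c u)))
        (dotz W ((ca (c t))%:num *: zpart (X t)
           + (Num.sqrt (ca (c t))%:num / 2) *: brvz (cV (c t)) (vpart (X t)))),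
      forall t : R, is_derive t 1 (fun u : R => (ca (c u))%:num)
        ((ca (c t))%:num * apart (X t)) &
      forall W, continuous (fun t : R => dots W (X t))].

Definition curve_length (X : R -> sT) : R :=
  \int[lebesgue_measure]_(t in `[0, 1]) Num.sqrt (dots (X t) (X t)).

(* joins p q l: some piecewise C^1 curve of length l joins p to q.  Each      *)
(* piece is parametrised by [0, 1]; requiring it to be the restriction of a   *)
(* C^1 curve defined on R is no loss of generality.                           *)
Inductive joins : damek_ricci -> damek_ricci -> R -> Prop :=
| joins_nil p : joins p p 0
| joins_cons c X q l : C1_curve c X -> joins (c 1) q l ->
    joins (c 0) q (curve_length X + l).

Definition dist (p q : damek_ricci) : R := inf [set l | joins p q l].

Definition busemann_ray (gamma : R -> damek_ricci) (x : damek_ricci) : R :=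
  lim ((dist (gamma t) x - t) @[t --> +oo]).

(* The ideal boundary N + {oo}: None is oo and Some (v, z) is a point of N. *)
Definition boundary := option (vT * zT).

(* A unit speed geodesic ray in the class theta: going up along the fibre of  *)
(* (0, 0) for oo, going down along the fibre of (v, z) for (v, z).  Asymptotic*)
(* rays have the same Busemann function up to a constant, so one ray per      *)
(* class suffices; busemann is normalised at the identity of S.               *)
Definition ray (theta : boundary) (t : R) : damek_ricci :=
  if theta is Some (v, z) then DamekRicci v z (expRp (- t))
  else DamekRicci 0 0 (expRp t).

Definition busemann (theta : boundary) (p : damek_ricci) : R :=
  busemann_ray (ray theta) p - busemann_ray (ray theta) oneS.

Definition Kop (J : zT -> vT -> vT) (V : vT) (Z X : zT) : zT :=
  brvz V (J X (J Z V)).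

(* A nonzero U in v orthogonal to J_z V + J_z J_Z V.  The Hessian acts on such*)
(* vectors by 1/2, and K carries no information about them: 1/2 is a root of  *)
(* the cubic for mu only if mu = -1, which need not be an eigenvalue of K^2   *)
(* (for instance, the domain of K is 0 when dim z = 1).                       *)
Definition has_K_free_vector (J : zT -> vT -> vT) (V : vT) (Z : zT) : Prop :=
  exists2 U : vT, U != 0 &
    forall X : zT, dotv U (J X V) = 0 /\ dotv U (J X (J Z V)) = 0.

Definition s4 (J : zT -> vT -> vT) (V : vT) (Z : zT) : {vspace sT} :=
  <<[:: inV V; inV (J Z V); inZ Z; vecA]>>%VS.

Definition s4perp (J : zT -> vT -> vT) (V : vT) (Z : zT) : {vspace sT} :=
  orthov dots (s4 J V Z).

End Nilpotent.

Section Spectrum.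
Variables (R : realType) (T : vectType R).

Definition eigenvalue_on (f : T -> T) (U : set T) (a : R) : Prop :=
  exists x, [/\ U x, x != 0 & f x = a *: x].

(* U is H-invariant and the eigenvalues of H restricted to U, with their      *)
(* multiplicities, are those listed in s.                                     *)
Definition has_spectrum (H : 'End(T)) (U : {vspace T}) (s : seq (R * nat)) :=
  [/\ (H @: U <= U)%VS,
      forall a d, (a, d) \in s -> \dim (U :&: passmx.leigenspace H a) = d &
      forall a, eigenvalue_on H [set` U] a <-> a \in [seq e.1 | e <- s]].

End Spectrum.

(* Main.v *)
Require Import Defs.
From HB Require Import structures.
From mathcomp Require Import all_boot all_order all_algebra sesquilinear.
From mathcomp Require Import all_classical all_reals all_analysis.
From mathcomp Require Import ring lra.
Import Order.TTheory GRing.Theory Num.Theory.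
Import numFieldNormedType.Exports.
Local Open Scope classical_set_scope.
Local Open Scope ring_scope.

(** Three things have to be understood: the Busemann functions, their Hessians, and
    the eigenvalues of these.

    Busemann functions. Write V, Z for the coordinates of theta relative to p (relpos), a for
    the height, E = a + |V|^2 / 4 and F = E^2 + |Z|^2. The candidates - log a and
    log F - log a have gradients of length one (grad_bus_unit), hence are 1-Lipschitz for the
    distance, because along a curve their increment is at most the integral of the speed
    (increment_le_Rintegral, dist_ge). As they take the value - t at the point gamma t of the
    chosen ray, they bound d (gamma t, p) - t from below. The opposite bound comes from
    explicit curves. For oo, move horizontally at height e^t and then descend vertically. For
    (v, z), the point p lies on an explicit geodesic ending at (v, z), namely the image of a
    vertical line under the inversion of a complex hyperbolic plane (geodesic_C1,
    geodesic_through), and the gap between it and the ray gamma closes as t grows. The excess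
    length tends to 0, so the candidates are the Busemann functions up to a constant
    (busemann_oo, busemann_pt).

    Hessians. Derivatives along left-invariant fields and the Koszul connection lc_nabla
    give the Hessian as an explicit bilinear form in terms of the bracket and J (hessian_oo,
    hessian_pt).

    Eigenvalues 0, 1/2, 1. For theta = oo, when V = 0 or Z = 0, and on s4 in general, the
    form becomes
      H X = (X - <w, X> w + P X) / 2
    with w the unit gradient and P the orthogonal projection to the image of an injective map
    e, defined on z or on a line, with values orthogonal to w. Then 0, 1 and 1/2 have as
    eigenspaces the line of w, the image of e and the orthogonal complement of both
    (split_spectrum). Behind this is the fact that V, J_Z V, Z and A span the tangent
    space of a complex hyperbolic plane, in which horospheres have principal curvatures 1/2
    and 1.

    The cubic. Let X be an eigenvector in the orthogonal complement of s4, with component xi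
    in v and y in z. The brackets u = [V, xi] and q = [J_Z V, xi] satisfy with y a linear
    system whose coefficients involve only K; eliminating u and q shows that y, or u if
    y = 0, is an eigenvector of K^2 and yields the cubic (s4perp_cubic). The only exception is
    a vector xi orthogonal to all J_T V and J_T J_Z V, on which H is 1/2. Since K is
    skew-symmetric, mu <= 0, and the inequality F >= a |V|^2 + |Z|^2 then excludes roots
    lambda <= 0 (cubic_pos). *)

Set Implicit Arguments.
Unset Strict Implicit.
Unset Printing Implicit Defensive.

(** * The inner products, the bracket and the maps J *)

Section InnerProducts.
Variables (R : realType) (n : vectType R) (G : metricLie2 n).
Implicit Types (U V W : vT G) (X Y Z : zT G).

Lemma dotvDl U V W : dotv (U + V) W = dotv U W + dotv V W.
Proof. exact: linearDl. Qed.
Lemma dotvDr U V W : dotv W (U + V) = dotv W U + dotv W V.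
Proof. exact: linearDr. Qed.
Lemma dotvZl a V W : dotv (a *: V) W = a * dotv V W.
Proof. exact: linearZl_LR. Qed.
Lemma dotvZr a V W : dotv W (a *: V) = a * dotv W V.
Proof. exact: linearZr_LR. Qed.
Lemma dotvNl V W : dotv (- V) W = - dotv V W.
Proof. exact: linearNl. Qed.
Lemma dotvNr V W : dotv W (- V) = - dotv W V.
Proof. exact: linearNr. Qed.
Lemma dotv0l W : dotv 0 W = 0.
Proof. exact: linear0l. Qed.
Lemma dotv0r W : dotv W 0 = 0.
Proof. exact: linear0r. Qed.
Lemma dotvC V W : dotv V W = dotv W V.
Proof. by rewrite /dotv hermC expr0 mul1r. Qed.

Lemma dotzDl X Y Z : dotz (X + Y) Z = dotz X Z + dotz Y Z.
Proof. exact: linearDl. Qed.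
Lemma dotzDr X Y Z : dotz Z (X + Y) = dotz Z X + dotz Z Y.
Proof. exact: linearDr. Qed.
Lemma dotzZl a Y Z : dotz (a *: Y) Z = a * dotz Y Z.
Proof. exact: linearZl_LR. Qed.
Lemma dotzZr a Y Z : dotz Z (a *: Y) = a * dotz Z Y.
Proof. exact: linearZr_LR. Qed.
Lemma dotzNl Y Z : dotz (- Y) Z = - dotz Y Z.
Proof. exact: linearNl. Qed.
Lemma dotzNr Y Z : dotz Z (- Y) = - dotz Z Y.
Proof. exact: linearNr. Qed.
Lemma dotz0l Z : dotz 0 Z = 0.
Proof. exact: linear0l. Qed.
Lemma dotz0r Z : dotz Z 0 = 0.
Proof. exact: linear0r. Qed.
Lemma dotzC Y Z : dotz Y Z = dotz Z Y.
Proof. by rewrite /dotz hermC expr0 mul1r. Qed.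

Lemma dotn_eq0 (x : n) : dotn G x x = 0 -> x = 0.
Proof.
move=> x0; apply/eqP; apply: contraT => xN0.
have : 0 < dotn G x x by exact: neq0_dnorm_gt0.
by rewrite x0 ltxx.
Qed.

Lemma dotv_ge0 V : 0 <= dotv V V. Proof. exact: dotn_ge0. Qed.
Lemma dotz_ge0 Z : 0 <= dotz Z Z. Proof. exact: dotn_ge0. Qed.
Lemma dotv_eq0 V : dotv V V = 0 -> V = 0.
Proof. by move=> V0; apply/val_inj/dotn_eq0. Qed.
Lemma dotz_eq0 Z : dotz Z Z = 0 -> Z = 0.
Proof. by move=> Z0; apply/val_inj/dotn_eq0. Qed.
Lemma dotv_gt0 V : V != 0 -> 0 < dotv V V.
Proof. by move=> V0; rewrite lt0r dotv_ge0 andbT; apply: contra_neq V0 => /dotv_eq0. Qed.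
Lemma dotz_gt0 Z : Z != 0 -> 0 < dotz Z Z.
Proof. by move=> Z0; rewrite lt0r dotz_ge0 andbT; apply: contra_neq Z0 => /dotz_eq0. Qed.

Lemma dotvP U V : (forall W, dotv U W = dotv V W) -> U = V.
Proof.
move=> UV; apply/eqP; rewrite -subr_eq0; apply/eqP/dotv_eq0.
by rewrite dotvDl dotvNl UV subrr.
Qed.
Lemma dotzP X Y : (forall Z, dotz X Z = dotz Y Z) -> X = Y.
Proof.
move=> UV; apply/eqP; rewrite -subr_eq0; apply/eqP/dotz_eq0.
by rewrite dotzDl dotzNl UV subrr.
Qed.

Lemma normv_sqr V : normv V ^+ 2 = dotv V V.
Proof. by rewrite sqr_sqrtr // dotv_ge0. Qed.
Lemma normz_sqr Z : normz Z ^+ 2 = dotz Z Z.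
Proof. by rewrite sqr_sqrtr // dotz_ge0. Qed.

Lemma brvzDl U V W : brvz (U + V) W = brvz U W + brvz V W.
Proof. by apply: val_inj; rewrite /= -![_ (vsproj _ _)]/(vsval _) !vsval_brvz linearDl. Qed.
Lemma brvzDr U V W : brvz W (U + V) = brvz W U + brvz W V.
Proof. by apply: val_inj; rewrite /= -![_ (vsproj _ _)]/(vsval _) !vsval_brvz linearDr. Qed.
Lemma brvzZl a V W : brvz (a *: V) W = a *: brvz V W.
Proof. by rewrite /brvz linearZl_LR linearZ. Qed.
Lemma brvzZr a V W : brvz W (a *: V) = a *: brvz W V.
Proof. by rewrite /brvz linearZr_LR linearZ. Qed.
Lemma brvzNl V W : brvz (- V) W = - brvz V W.
Proof. by rewrite -scaleN1r brvzZl scaleN1r. Qed.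
Lemma brvzNr V W : brvz W (- V) = - brvz W V.
Proof. by rewrite -scaleN1r brvzZr scaleN1r. Qed.
Lemma brvz0l W : brvz 0 W = 0.
Proof. by rewrite -(scale0r 0) brvzZl scale0r. Qed.
Lemma brvz0r W : brvz W 0 = 0.
Proof. by rewrite -(scale0r 0) brvzZr scale0r. Qed.
Lemma brvz_alt V : brvz V V = 0.
Proof. by rewrite /brvz lie_alt linear0. Qed.
Lemma brvzC V W : brvz V W = - brvz W V.
Proof.
apply/eqP; rewrite -addr_eq0; apply/eqP.
by have := brvz_alt (V + W); rewrite brvzDl !brvzDr !brvz_alt add0r addr0.
Qed.

Definition dotvE := (dotvDl, dotvDr, dotvNl, dotvNr, dotvZl, dotvZr, dotv0l, dotv0r).
Definition dotzE := (dotzDl, dotzDr, dotzNl, dotzNr, dotzZl, dotzZr, dotz0l, dotz0r).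
Definition brvzE := (brvzDl, brvzDr, brvzNl, brvzNr, brvzZl, brvzZr, brvz0l, brvz0r).

End InnerProducts.

Section Clifford.
Variables (R : realType) (n : vectType R) (G : metricLie2 n).
Variables (J : zT G -> vT G -> vT G) (hJ : generalized_heisenberg J).
Implicit Types (U V W : vT G) (X Y Z : zT G).

Lemma dotvJl Z V W : dotv (J Z V) W = dotz Z (brvz V W).
Proof. by case: hJ. Qed.
Lemma dotvJr Z V W : dotv W (J Z V) = dotz Z (brvz V W).
Proof. by rewrite dotvC dotvJl. Qed.
Lemma JJ Z V : J Z (J Z V) = - dotz Z Z *: V.
Proof. by case: hJ => _ ->; rewrite normz_sqr. Qed.

Lemma JDl Y Z V : J (Y + Z) V = J Y V + J Z V.
Proof. by apply: dotvP => W; rewrite dotvE !dotvJl dotzE. Qed.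
Lemma JZl a Z V : J (a *: Z) V = a *: J Z V.
Proof. by apply: dotvP => W; rewrite dotvE !dotvJl dotzE. Qed.
Lemma JDr Z V W : J Z (V + W) = J Z V + J Z W.
Proof. by apply: dotvP => U; rewrite dotvE !dotvJl brvzE dotzE. Qed.
Lemma JZr a Z V : J Z (a *: V) = a *: J Z V.
Proof. by apply: dotvP => U; rewrite dotvE !dotvJl brvzE dotzE. Qed.
Lemma JNl Z V : J (- Z) V = - J Z V.
Proof. by rewrite -scaleN1r JZl scaleN1r. Qed.
Lemma JNr Z V : J Z (- V) = - J Z V.
Proof. by rewrite -scaleN1r JZr scaleN1r. Qed.
Lemma J0l V : J 0 V = 0.
Proof. by rewrite -(scale0r 0) JZl scale0r. Qed.
Lemma J0r Z : J Z 0 = 0.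
Proof. by rewrite -(scale0r (0 : vT G)) JZr !scale0r. Qed.
Definition JE := (JDl, JDr, JNl, JNr, JZl, JZr, J0l, J0r).

Lemma J_skew Z V W : dotv (J Z V) W = - dotv V (J Z W).
Proof. by rewrite dotvJl dotvJr brvzC dotzE. Qed.

Lemma dotvJJ Z V W : dotv (J Z V) (J Z W) = dotz Z Z * dotv V W.
Proof. by rewrite J_skew JJ dotvE; ring. Qed.

(** Polarisation in Z of J_Z^2 = - |Z|^2, that is, the Clifford relation
    J_X J_Y + J_Y J_X = - 2 <X, Y> read through the skew-symmetry of J. *)
Lemma dotvJJ_polar X Y V W :
  dotv (J X V) (J Y W) + dotv (J Y V) (J X W) = 2 * dotz X Y * dotv V W.
Proof.
have := dotvJJ (X + Y) V W.
rewrite !JE !dotvE !dotzE !dotvJJ [dotz Y X]dotzC => e.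
by apply: (addrI (dotz X X * dotv V W + dotz Y Y * dotv V W)); move: e; lra.
Qed.

Lemma dotvJJ_diag X Y V : dotv (J X V) (J Y V) = dotz X Y * dotv V V.
Proof.
have := dotvJJ_polar X Y V V; rewrite [dotv (J Y V) _]dotvC; lra.
Qed.

(** Because of this identity V, J_Z V, Z and A span a subalgebra of s; it is the
    Lie algebra of a complex hyperbolic plane through p and theta. *)
Lemma brvzJ Y V : brvz V (J Y V) = dotv V V *: Y.
Proof.
by apply: dotzP => W; rewrite dotzC -dotvJl dotvJJ_diag dotzE dotzC mulrC.
Qed.
End Clifford.

(** * Riesz representation *)

Section Riesz.
Variables (R : realType) (T : vectType R) (d : {dot T for idfun}).

Let dform (w : T) : 'Hom(T, R^o) := linfun (d w : T -> R^o).

Let dform_linear : linear dform.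
Proof.
move=> a u v; apply/lfunP => y.
by rewrite add_lfunE scale_lfunE !lfunE /= linearPl.
Qed.

HB.instance Definition _ := GRing.isLinear.Build R T 'Hom(T, R^o) *:%R dform
  dform_linear.

Lemma riesz (phi : {linear T -> R^o}) : exists w, forall x, phi x = d w x.
Proof.
pose D : 'Hom(T, 'Hom(T, R^o)) := linfun dform.
have kD : lker D = 0%VS.
  apply/eqP/lker0P => u v /eqP; rewrite -subr_eq0 -linearB /= lfunE /= => /eqP duv.
  apply/eqP; rewrite -subr_eq0; apply: contraT => uv0.
  have : 0 < d (u - v) (u - v) by exact: neq0_dnorm_gt0.
  have := congr1 (fun h : 'Hom(T, R^o) => h (u - v)) duv.
  by rewrite !lfunE /= => ->; rewrite ltxx.
have fD : limg D = fullv.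
  apply/eqP; rewrite eqEdim subvf /=.
  have := limg_ker_dim D fullv.
  by rewrite kD capv0 dimv0 add0n => ->; rewrite !dimvf /dim /= muln1.
have /memv_imgP[w _ e] : linfun phi \in limg D by rewrite fD memvf.
exists w => x.
by rewrite -[LHS](lfunE phi) e !lfunE.
Qed.

(** The vectors w i represent the coordinate forms of an arbitrary basis; they
    serve where an orthonormal basis would, and need no orthogonalisation. *)
Lemma dual_basis : exists w : 'I_(\dim {:T}) -> T,
  forall x, x = \sum_i d (w i) x *: (vbasis {:T})`_i.
Proof.
have h i : exists w, forall x, coord (vbasis {:T}) i x = d w x.
  exact: (riesz (coord (vbasis {:T}) i : {linear T -> R^o})).
have [w hw] := choice h.
by exists w => x; rewrite [LHS](coord_vbasis (memvf x)); apply: eq_bigr => i _; rewrite hw.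
Qed.

End Riesz.

(** * Derivatives of real functions and weak derivatives of curves *)

Section RealDerivatives.
Variable R : realType.

(** A constant that is not a type class: derivatives are then found by unification
    with the rules below, and no instance search assigns them. *)
Definition deriv_at (f : R -> R) (t d : R) := is_derive t 1 f d.

Implicit Types (f g : R -> R) (t df dg : R).

Lemma deriv_at_eq f t df df' : deriv_at f t df -> df = df' -> deriv_at f t df'.
Proof. by move=> d <-. Qed.

Lemma deriv_at_cst (k : R) t : deriv_at (fun=> k) t 0.
Proof. exact: is_derive_cst. Qed.

Lemma deriv_at_id t : deriv_at (fun u => u) t 1.
Proof. exact: is_derive_id. Qed.

Lemma deriv_at_add f g t df dg : deriv_at f t df -> deriv_at g t dg ->
  deriv_at (fun u => f u + g u) t (df + dg).
Proof. exact: is_deriveD. Qed.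

Lemma deriv_at_opp f t df : deriv_at f t df ->
  deriv_at (fun u => - f u) t (- df).
Proof. exact: is_deriveN. Qed.

Lemma deriv_at_mul f g t df dg : deriv_at f t df -> deriv_at g t dg ->
  deriv_at (fun u => f u * g u) t (df * g t + f t * dg).
Proof.
move=> d1 d2; apply: (is_derive_eq (is_deriveM d1 d2)).
by rewrite [RHS]addrC; congr (_ + _); exact: mulrC.
Qed.

Lemma deriv_at_inv f t df : f t != 0 -> deriv_at f t df ->
  deriv_at (fun u => (f u)^-1) t (- df / f t ^+ 2).
Proof.
move=> f0 d; apply: (is_derive_eq (is_deriveV f0 d)).
by rewrite -[_ *: _]/(_ * _) mulNr mulrC mulNr.
Qed.

Lemma deriv_at_ln f t df : 0 < f t -> deriv_at f t df ->
  deriv_at (fun u => ln (f u)) t (df / f t).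
Proof.
move=> f0 d; have d1 := is_derive1_ln f0.
by apply: (is_derive_eq (is_derive1_comp d1 d)); rewrite [LHS]mulrC.
Qed.

Lemma deriv_at_sqrt f t df : 0 < f t -> deriv_at f t df ->
  deriv_at (fun u => Num.sqrt (f u)) t (df / (2 * Num.sqrt (f t))).
Proof.
move=> f0 d; have d1 := is_derive1_sqrt f0.
by apply: (is_derive_eq (is_derive1_comp d1 d)); rewrite [LHS]mulrC.
Qed.

Lemma deriv_at_exp f t df : deriv_at f t df ->
  deriv_at (fun u => expR (f u)) t (df * expR (f t)).
Proof.
move=> d; have d1 := is_derive_expR (f t).
by apply: (is_derive_eq (is_derive1_comp d1 d)); rewrite [LHS]mulrC.
Qed.

Lemma deriv_at_continuous f : (forall t, exists d, deriv_at f t d) -> continuous f.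
Proof.
move=> fd t; have [d [h _]] := fd t.
by apply: differentiable_continuous; apply/derivable1_diffP.
Qed.

End RealDerivatives.

Section WeakCalculus.
Variables (R : realType) (T : vectType R) (d : {dot T for idfun}).

(** The space T carries no topology here. Differentiating every linear form is the
    notion in which C1_curve is phrased, and in finite dimension it loses nothing. *)
Definition weak_derive (x : R -> T) (t : R) (x' : T) :=
  forall w, deriv_at (fun u => d w (x u) : R) t (d w x').
Definition weak_continuous (x : R -> T) :=
  forall w, continuous (fun u => d w (x u) : R).

Lemma weak_derive_form (phi : T -> R) x t x' : linear_for *%R phi ->
  weak_derive x t x' -> deriv_at (fun u => phi (x u)) t (phi x').
Proof.
move=> lphi; pose phiL : {linear T -> R^o} :=
  HB.pack (phi : T -> R^o) (GRing.isLinear.Build R T R^o *:%R phi lphi).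
have [w hw] := riesz d phiL => /(_ w).
by rewrite -(hw x'); under eq_fun do rewrite -hw.
Qed.

Lemma weak_continuous_form (phi : T -> R) x : linear_for *%R phi ->
  weak_continuous x -> continuous (fun u => phi (x u)).
Proof.
move=> lphi; pose phiL : {linear T -> R^o} :=
  HB.pack (phi : T -> R^o) (GRing.isLinear.Build R T R^o *:%R phi lphi).
by have [w hw] := riesz d phiL => /(_ w); under eq_fun do rewrite -hw.
Qed.

(** Expanding one argument only turns a bilinear expression of two curves into a
    finite sum of products of real functions. *)
Lemma bilinear_expand (b : T -> T -> R) : (forall y, linear_for *%R (b^~ y)) ->
  exists w e : 'I_(\dim {:T}) -> T,
  forall x y, b x y = \sum_i d (w i) x * b (e i) y.
Proof.
move=> lb; have [w hw] := dual_basis d.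
exists w; exists (fun i => (vbasis {:T})`_i) => x y.
pose phi : {linear T -> R^o} :=
  HB.pack (b^~ y : T -> R^o) (GRing.isLinear.Build R T R^o *:%R (b^~ y) (lb y)).
rewrite -[LHS]/(phi x) [in LHS](hw x) linear_sum; apply: eq_bigr => i _.
by rewrite linearZ.
Qed.

Lemma weak_derive_bilinear (b : T -> T -> R) x y t x' y' :
  (forall y, linear_for *%R (b^~ y)) -> (forall x, linear_for *%R (b x)) ->
  weak_derive x t x' -> weak_derive y t y' ->
  deriv_at (fun u => b (x u) (y u)) t (b x' (y t) + b (x t) y').
Proof.
move=> bl br dx dy; have [w [e he]] := bilinear_expand bl.
rewrite !he -big_split /=; under eq_fun do rewrite he.
have -> : (fun u => \sum_i (d (w i) (x u) * b (e i) (y u))) =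
  \sum_i (fun u => d (w i) (x u) * b (e i) (y u)).
  by apply/funext => u; rewrite fct_sumE.
apply: is_derive_sum => i.
have d1 := dx (w i); have d2 := weak_derive_form (br (e i)) dy.
apply: (is_derive_eq (is_deriveM d1 d2)).
by rewrite [RHS]addrC; congr (_ + _); exact: mulrC.
Qed.

Lemma weak_continuous_bilinear (b : T -> T -> R) x y :
  (forall y, linear_for *%R (b^~ y)) -> (forall x, linear_for *%R (b x)) ->
  weak_continuous x -> weak_continuous y ->
  continuous (fun u => b (x u) (y u)).
Proof.
move=> bl br dx dy; have [w [e he]] := bilinear_expand bl.
under eq_fun do rewrite he.
move=> t; apply: cvg_big => [|i _]; first exact: add_continuous.
by apply: cvgM; [exact: dx | exact: weak_continuous_form (br (e i)) dy t].
Qed.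

End WeakCalculus.

(** Only the bound g is continuous, so f need not be the integral of df: a primitive of g
    minus f has nonnegative derivative, hence is nondecreasing on [0, 1]. *)
Lemma increment_le_Rintegral (R : realType) (f df g : R -> R) :
  (forall t, deriv_at f t (df t)) -> (forall t, df t <= g t) -> continuous g ->
  f 1 - f 0 <= \int[lebesgue_measure]_(t in `[0, 1]) g t.
Proof.
move=> fd dfg cg.
(* Based at - 1, the primitive P is differentiable at both ends of [0, 1]. *)
pose P x := \int[lebesgue_measure]_(t in `[-1, x]) g t.
have Pd (x : R) : -1 < x -> x < 2 -> is_derive x 1 P (g x).
  move=> x1 x2; have := @continuous_FTC1_closed R g (-1) x 2 x2 _ x1 (cg x).
  case.
    apply: continuous_compact_integrable; first exact: segment_compact.
    exact: continuous_subspaceT.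
  by move=> dP eP; split=> //; rewrite -derive1E.
have Pc (x : R) : -1 < x -> x < 2 -> {for x, continuous P}.
  by move=> x1 x2; apply: differentiable_continuous; apply/derivable1_diffP; case: (Pd x x1 x2).
have itv (x : R) : x \in `]0, 1[ -> -1 < x /\ x < 2.
  by rewrite in_itv /= => /andP[x0 x1]; split; lra.
have -> : \int[lebesgue_measure]_(t in `[0, 1]) g t = P 1 - P 0.
  rewrite /Rintegral (@continuous_FTC2 R g P 0 1) //=.
  - exact: continuous_subspaceT.
  - split.
    + by move=> x /itv[x0 x1]; case: (Pd x x0 x1).
    + by apply: cvg_at_right_filter; apply: Pc; lra.
    + by apply: cvg_at_left_filter; apply: Pc; lra.
  - by move=> x /itv[x0 x1]; rewrite derive1E; case: (Pd x x0 x1).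
have hd (x : R) : -1 < x -> x < 2 -> is_derive x 1 (P - f) (g x - df x).
  by move=> x0 x1; have := Pd x x0 x1 => ?; have := fd x => ?; exact: is_deriveB.
have : (P - f) 0 <= (P - f) 1.
  apply: (@ger0_derive1_le_cc R (P - f) 0 1) => //.
  - by move=> x /itv[x0 x1]; case: (hd x x0 x1).
  - move=> x /itv[x0 x1]; rewrite derive1E; case: (hd x x0 x1) => _ ->.
    by rewrite subr_ge0.
  - apply: continuous_in_subspaceT => x; rewrite inE /= in_itv /= => /andP[x0 x1].
    have x0' : -1 < x by lra.
    have x1' : x < 2 by lra.
    by apply: differentiable_continuous; apply/derivable1_diffP; case: (hd x x0' x1').
  - by rewrite in_itv /= lexx ler01.
  - by rewrite in_itv /= lexx ler01.
rewrite -![(P - f) _]/(P _ - f _); lra.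
Qed.

(** * Busemann functions in coordinates relative to a boundary point *)

Section Horospherical.
Variables (R : realType) (n : vectType R) (G : metricLie2 n).
Implicit Types (p q : damek_ricci G) (x X Y : sT G) (v : vT G) (z : zT G).

(** Statements mention this constant, and not dots, so that the structure of inner product
    on s is found once and for all. *)
Definition dotS : {dot (sT G) for idfun} := @dots R n G.

(** The product (V, Z)^-1 (v, z) in N, together with the height a of p = (V, Z, a).
    The Busemann function of (v, z) depends on p through these data only. *)
Definition relpos v z p : sT G :=
  (v - cV p, z - cZ p - (1 / 2) *: brvz (cV p) v, (ca p)%:num).

(** The velocity of relpos along a curve whose left-translated velocity is X
    (see relpos_derive); it depends on the position through relpos alone, which is the
    left invariance of the metric. *)
Definition relvel x X : sT G :=
  (- Num.sqrt (apart x) *: vpart X,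
   - apart x *: zpart X + (Num.sqrt (apart x) / 2) *: brvz (vpart x) (vpart X),
   apart x * apart X).

(** The square root of the first term of busF, which is the function F of the statement;
    up to a constant, the Busemann function is log (busF / a). *)
Definition busE x : R := apart x + dotv (vpart x) (vpart x) / 4.
Definition busF x : R := busE x ^+ 2 + dotz (zpart x) (zpart x).

(** The derivative of busF along the left-invariant vector field Y. *)
Definition dbusF x Y : R :=
  2 * busE x * (apart x * apart Y - Num.sqrt (apart x) / 2 * dotv (vpart x) (vpart Y))
  - 2 * apart x * dotz (zpart x) (zpart Y)
  + Num.sqrt (apart x) * dotz (zpart x) (brvz (vpart x) (vpart Y)).

(** The derivative of dbusF . Y along the left-invariant vector field X. *)
Definition d2busF x X Y : R :=
  let s := Num.sqrt (apart x) in
  2 * (apart x * apart X - s / 2 * dotv (vpart x) (vpart X))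
    * (apart x * apart Y - s / 2 * dotv (vpart x) (vpart Y))
  + 2 * busE x * (apart x * apart X * apart Y
      - s / 4 * apart X * dotv (vpart x) (vpart Y)
      + apart x / 2 * dotv (vpart X) (vpart Y))
  - 2 * apart x * apart X * dotz (zpart x) (zpart Y)
  + 2 * apart x * (apart x * dotz (zpart X) (zpart Y)
      - s / 2 * dotz (brvz (vpart x) (vpart X)) (zpart Y))
  + s / 2 * apart X * dotz (zpart x) (brvz (vpart x) (vpart Y))
  + s * (- apart x * dotz (zpart X) (brvz (vpart x) (vpart Y))
      + s / 2 * dotz (brvz (vpart x) (vpart X)) (brvz (vpart x) (vpart Y))
      - s * dotz (zpart x) (brvz (vpart X) (vpart Y))).

Definition has_velocity (c : R -> damek_ricci G) (t : R) X :=
  [/\ forall W, is_derive t 1 (fun u : R => dotv W (cV (c u)))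
        (dotv W (Num.sqrt (ca (c t))%:num *: vpart X)),
      forall W, is_derive t 1 (fun u : R => dotz W (cZ (c u)))
        (dotz W ((ca (c t))%:num *: zpart X
           + (Num.sqrt (ca (c t))%:num / 2) *: brvz (cV (c t)) (vpart X))) &
      is_derive t 1 (fun u : R => (ca (c u))%:num)
        ((ca (c t))%:num * apart X)].

Lemma partE (U : vT G) (Y : zT G) (s : R) :
  (vpart (U, Y, s) = U) * (zpart (U, Y, s) = Y) * (apart (U, Y, s) = s).
Proof. by []. Qed.

Lemma sT_partD x X a : (vpart (a *: x + X) = a *: vpart x + vpart X)
  * (zpart (a *: x + X) = a *: zpart x + zpart X)
  * (apart (a *: x + X) = a * apart x + apart X).
Proof. by []. Qed.

Lemma dotsE x X : dots x X = dotv (vpart x) (vpart X) + dotz (zpart x) (zpart X)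
  + apart x * apart X.
Proof. by []. Qed.

Section Chain.
Variables (J : zT G -> vT G -> vT G) (hJ : generalized_heisenberg J).

(** Tested on W, the term [V, v] becomes a linear form in V by the definition of J,
    so the weak derivatives of the components of the curve are enough. *)
Lemma relpos_derive v z c t X : has_velocity c t X ->
  weak_derive dotS (fun u => relpos v z (c u)) t
    (relvel (relpos v z (c t)) X).
Proof.
case=> dv dz da W; rewrite /relpos /relvel.
pose W1 := - vpart W + (1 / 2) *: J (zpart W) v.
pose k := dotv (vpart W) v + dotz (zpart W) z.
have -> : (fun u => dotS W (v - cV (c u),
    z - cZ (c u) - (1 / 2) *: brvz (cV (c u)) v, (ca (c u))%:num)) =
  (fun u => (k + (dotv W1 (cV (c u)) - dotz (zpart W) (cZ (c u))))
     + apart W * (ca (c u))%:num).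
  apply/funext => u; rewrite [dotS _ _]dotsE !partE /k /W1 !dotvE !dotzE (dotvJl hJ).
  by rewrite (brvzC v) dotzNr; ring.
apply: deriv_at_eq.
  apply: deriv_at_add.
    apply: deriv_at_add; first exact: deriv_at_cst.
    apply: deriv_at_add; first exact: dv.
    apply: deriv_at_opp; exact: dz.
  apply: deriv_at_mul; first exact: deriv_at_cst.
  exact: da.
rewrite [dotS _ _]dotsE !partE /W1 !brvzE !dotvE !dotzE (dotvJl hJ).
by rewrite (brvzC v) dotzNr; field.
Qed.

Variables (x : R -> sT G) (t : R) (X : sT G).
Hypothesis dx : weak_derive dotS x t (relvel (x t) X).
Hypothesis xpos : 0 < apart (x t).

Let da : deriv_at (fun u => apart (x u)) t (apart (x t) * apart X).
Proof. by apply: (weak_derive_form _ dx) => a u y. Qed.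

Let dVY (Y : vT G) : deriv_at (fun u => dotv (vpart (x u)) Y) t
  (- Num.sqrt (apart (x t)) * dotv (vpart X) Y).
Proof.
apply: deriv_at_eq.
  apply: (weak_derive_form (phi := fun y => dotv (vpart y) Y) _ dx) => a u y.
  by rewrite sT_partD !dotvE.
by rewrite /relvel !partE dotvE.
Qed.

Let dZY (Y : zT G) : deriv_at (fun u => dotz (zpart (x u)) Y) t
  (- apart (x t) * dotz (zpart X) Y
    + Num.sqrt (apart (x t)) / 2 * dotz (brvz (vpart (x t)) (vpart X)) Y).
Proof.
apply: deriv_at_eq.
  apply: (weak_derive_form (phi := fun y => dotz (zpart y) Y) _ dx) => a u y.
  by rewrite sT_partD !dotzE.
by rewrite /relvel !partE !dotzE.
Qed.

Let ds : deriv_at (fun u => Num.sqrt (apart (x u))) t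
   (Num.sqrt (apart (x t)) / 2 * apart X).
Proof.
apply: (deriv_at_eq (deriv_at_sqrt xpos da)).
have s0 : Num.sqrt (apart (x t)) != 0 by rewrite sqrtr_eq0 -ltNge.
by rewrite -{1}(sqr_sqrtr (ltW xpos)); field.
Qed.

Let dVV : deriv_at (fun u => dotv (vpart (x u)) (vpart (x u))) t
  (- 2 * Num.sqrt (apart (x t)) * dotv (vpart (x t)) (vpart X)).
Proof.
apply: deriv_at_eq.
  apply: (weak_derive_bilinear (b := fun y y' => dotv (vpart y) (vpart y')) _ _ dx dx) => w
      a u y.
    by rewrite sT_partD !dotvE.
  by rewrite sT_partD !dotvE.
by rewrite /relvel !partE !dotvE [dotv (vpart X) _]dotvC; ring.
Qed.

Let dZZ : deriv_at (fun u => dotz (zpart (x u)) (zpart (x u))) t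
  (2 * (- apart (x t) * dotz (zpart (x t)) (zpart X)
    + Num.sqrt (apart (x t)) / 2 * dotz (zpart (x t)) (brvz (vpart (x t)) (vpart X)))).
Proof.
apply: deriv_at_eq.
  apply: (weak_derive_bilinear (b := fun y y' => dotz (zpart y) (zpart y')) _ _ dx dx) => w
      a u y.
    by rewrite sT_partD !dotzE.
  by rewrite sT_partD !dotzE.
by rewrite /relvel !partE !dotzE [dotz (zpart X) _]dotzC [dotz (brvz _ _) _]dotzC; ring.
Qed.

Let dZVY (Y : vT G) : deriv_at (fun u => dotz (zpart (x u)) (brvz (vpart (x u)) Y)) t
  (- apart (x t) * dotz (zpart X) (brvz (vpart (x t)) Y)
    + Num.sqrt (apart (x t)) / 2
       * dotz (brvz (vpart (x t)) (vpart X)) (brvz (vpart (x t)) Y)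
   - Num.sqrt (apart (x t)) * dotz (zpart (x t)) (brvz (vpart X) Y)).
Proof.
apply: deriv_at_eq.
  apply: (weak_derive_bilinear (b := fun y y' => dotz (zpart y) (brvz (vpart y') Y)) _ _ dx
      dx) => w a u y.
    by rewrite sT_partD !dotzE.
  by rewrite sT_partD !brvzE !dotzE.
by rewrite /relvel !partE !brvzE !dotzE; ring.
Qed.

Let dE : deriv_at (fun u => busE (x u)) t
  (apart (x t) * apart X - Num.sqrt (apart (x t)) / 2 * dotv (vpart (x t)) (vpart X)).
Proof.
apply: deriv_at_eq.
  apply: deriv_at_add; first exact: da.
  apply: deriv_at_mul; first exact: dVV.
  exact: deriv_at_cst.
by cbv beta; field.
Qed.

Lemma busF_derive : deriv_at (fun u => busF (x u)) t (dbusF (x t) X).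
Proof.
apply: deriv_at_eq.
  apply: deriv_at_add; last exact: dZZ.
  by apply: deriv_at_mul; exact: dE.
by rewrite /dbusF; cbv beta; field.
Qed.

Lemma dbusF_derive Y : deriv_at (fun u => dbusF (x u) Y) t (d2busF (x t) X Y).
Proof.
apply: deriv_at_eq.
  apply: deriv_at_add.
    apply: deriv_at_add.
      apply: deriv_at_mul.
        apply: deriv_at_mul; first exact: deriv_at_cst.
        exact: dE.
      apply: deriv_at_add.
        apply: deriv_at_mul; first exact: da.
        exact: deriv_at_cst.
      apply: deriv_at_opp; apply: deriv_at_mul.
        apply: deriv_at_mul; first exact: ds.
        exact: deriv_at_cst.
      exact: dVY.
    apply: deriv_at_opp; apply: deriv_at_mul; last exact: dZY.
    apply: deriv_at_mul; first exact: deriv_at_cst.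
    exact: da.
  apply: deriv_at_mul; first exact: ds.
  exact: dZVY.
rewrite /d2busF; cbv beta.
have := sqr_sqrtr (ltW xpos); set s := Num.sqrt _ => sE.
by rewrite -sE; field.
Qed.

End Chain.
End Horospherical.

(** * The gradient has length one *)

Section Gradient.
Variables (R : realType) (n : vectType R) (G : metricLie2 n).
Variables (J : zT G -> vT G -> vT G) (hJ : generalized_heisenberg J).
Implicit Types (p q : damek_ricci G) (x X Y : sT G) (v : vT G) (z : zT G).

Lemma busE_gt0 x : 0 < apart x -> 0 < busE x.
Proof. by move=> x0; rewrite /busE ltr_wpDr // divr_ge0 // dotv_ge0. Qed.

Lemma busF_gt0 x : 0 < apart x -> 0 < busF x.
Proof. by move=> x0; rewrite /busF ltr_wpDr ?dotz_ge0 // exprn_gt0 // busE_gt0. Qed.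

(** The gradient of busF, the vector dual to dbusF (see dots_grad_busF). *)
Definition grad_busF x : sT G :=
  (Num.sqrt (apart x) *: (J (zpart x) (vpart x) - busE x *: vpart x),
   - (2 * apart x) *: zpart x, 2 * apart x * busE x).

Lemma dots_grad_busF x Y : 0 < apart x -> dots (grad_busF x) Y = dbusF x Y.
Proof.
move=> x0; rewrite dotsE /grad_busF !partE !dotvE !dotzE (dotvJl hJ) /dbusF.
have := sqr_sqrtr (ltW x0); set s := Num.sqrt _ => sE.
by rewrite -sE; field.
Qed.

(** Here the Clifford relation enters: |J_Z V|^2 = |Z|^2 |V|^2 and J_Z V is orthogonal
    to V, so that F = E^2 + |Z|^2 factors out. *)
Lemma grad_busF_sqr x : 0 < apart x -> dots (grad_busF x) (grad_busF x) = 4 * apart x * busE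
    x * busF x.
Proof.
move=> x0; rewrite dots_grad_busF // /dbusF /grad_busF !partE !dotvE !brvzE !dotzE.
rewrite (brvzJ hJ) brvz_alt !dotzE (dotvJr hJ) brvz_alt !dotzE.
have := sqr_sqrtr (ltW x0); set s := Num.sqrt _ => sE.
have -> : dotv (vpart x) (vpart x) = 4 * (busE x - apart x) by rewrite /busE; field.
by rewrite /busF -sE; field.
Qed.

(** The gradient of log busF - log a. *)
Definition grad_bus x : sT G := (busF x)^-1 *: grad_busF x - vecA G.

Lemma dotsDl X Y x : dots (X + Y) x = dots X x + dots Y x.
Proof. exact: linearDl. Qed.
Lemma dotsZl a X x : dots (a *: X) x = a * dots X x.
Proof. exact: linearZl_LR. Qed.
Lemma dotsNl X x : dots (- X) x = - dots X x.
Proof. exact: linearNl. Qed.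
Lemma dotsC X Y : dots X Y = dots Y X.
Proof. by rewrite dots_herm expr0 mul1r. Qed.
Lemma dotsDr X Y x : dots x (X + Y) = dots x X + dots x Y.
Proof. by rewrite dotsC dotsDl ![dots _ x]dotsC. Qed.
Lemma dotsZr a X x : dots x (a *: X) = a * dots x X.
Proof. by rewrite dotsC dotsZl dotsC. Qed.
Lemma dotsNr X x : dots x (- X) = - dots x X.
Proof. by rewrite dotsC dotsNl dotsC. Qed.
Lemma dots_vecA X : dots (vecA G) X = apart X.
Proof. by rewrite dotsE /vecA !partE dotvE dotzE !add0r mul1r. Qed.
Lemma dots_ge0 X : 0 <= dots X X.
Proof. by rewrite dotsE !addr_ge0 ?dotv_ge0 ?dotz_ge0 // -expr2 sqr_ge0. Qed.

Lemma dots_grad_bus x Y : 0 < apart x -> dots (grad_bus x) Y = dbusF x Y / busF x - apart Y.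
Proof.
by move=> x0; rewrite dotsDl dotsZl dotsNl dots_grad_busF // dots_vecA mulrC.
Qed.

(** With P the gradient of F, |P|^2 = 4 a E F and <P, A> = 2 a E; the square of
    P / F - A is therefore 4 a E / F - 4 a E / F + 1. *)
Lemma grad_bus_unit x : 0 < apart x -> dots (grad_bus x) (grad_bus x) = 1.
Proof.
move=> x0; rewrite dots_grad_bus // -dots_grad_busF // /grad_bus dotsDr dotsZr grad_busF_sqr
    // dotsNr.
rewrite [dots _ (vecA G)]dotsC dots_vecA.
have := lt0r_neq0 (busF_gt0 x0) => F0.
by rewrite -[apart (_ + _)]/((busF x)^-1 * apart (grad_busF x) - 1) /grad_busF !partE; field.
Qed.

(** The Cauchy-Schwarz inequality, from the square of X - <Y, X> Y. *)
Lemma dots_unit_le Y X : dots Y Y = 1 -> dots Y X <= Num.sqrt (dots X X).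
Proof.
move=> Y1; apply: (le_trans (ler_norm _)); rewrite -sqrtr_sqr ler_wsqrtr //.
have := dots_ge0 (X - dots Y X *: Y).
by rewrite dotsDl dotsNl dotsZl !dotsDr !dotsNr !dotsZr Y1 [dots X Y]dotsC; lra.
Qed.

Definition bus v z p : R := ln (busF (relpos v z p)) - ln (ca p)%:num.

Lemma height_velocity c t X : has_velocity c t X ->
  deriv_at (fun u => (ca (c u))%:num) t ((ca (c t))%:num * apart X).
Proof. by case. Qed.

Lemma relpos_gt0 v z p : 0 < apart (relpos v z p).
Proof. by rewrite /relpos partE. Qed.

Lemma bus_derive v z c t X : has_velocity c t X ->
  deriv_at (fun u => bus v z (c u)) t (dots (grad_bus (relpos v z (c t))) X).
Proof.
move=> h; have da := height_velocity h; have dx := relpos_derive hJ v z h.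
have x0 := relpos_gt0 v z (c t).
apply: deriv_at_eq.
  apply: deriv_at_add; first by apply: deriv_at_ln; [exact: busF_gt0|exact: busF_derive dx].
  by apply: deriv_at_opp; apply: deriv_at_ln da.
rewrite dots_grad_bus //; congr (_ - _).
by rewrite mulrAC divff ?mul1r // lt0r_neq0.
Qed.

Lemma height_derive c t X : has_velocity c t X ->
  deriv_at (fun u => - ln (ca (c u))%:num) t (dots (- vecA G) X).
Proof.
move=> h; have da := height_velocity h; apply: deriv_at_eq.
  by apply: deriv_at_opp; apply: deriv_at_ln da.
by rewrite dotsNl dots_vecA; congr (- _); rewrite mulrAC divff ?mul1r // lt0r_neq0.
Qed.

End Gradient.

(** * Lengths of curves and the distance *)

Section Length.
Variables (R : realType) (n : vectType R) (G : metricLie2 n).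
Implicit Types (p q : damek_ricci G) (X Y : sT G).

Lemma C1_velocity c (X : R -> sT G) t : C1_curve c X -> has_velocity c t (X t).
Proof. by case=> dv dz da _; split. Qed.

Lemma speed_continuous c (X : R -> sT G) : C1_curve c X ->
  continuous (fun t => Num.sqrt (dots (X t) (X t))).
Proof.
case=> _ _ _ cX t; apply: (continuous_comp (f := fun t => dots (X t) (X t))); last exact:
    sqrt_continuous.
apply: (weak_continuous_bilinear (d := dotS G) (b := @dots R n G)) => //.
- by move=> Y a x y; rewrite dotsDl dotsZl.
- by move=> Y a x y; rewrite dotsDr dotsZr.
Qed.

(** Such a function is 1-Lipschitz for the distance (see dist_ge); Busemann functions
    give lower bounds of distances in this way. *)
Definition unit_gradient (f : damek_ricci G -> R) :=
  forall c t X, has_velocity c t X ->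
    exists2 Y, dots Y Y = 1 & deriv_at (fun u => f (c u)) t (dots Y X).

Lemma joins_ge f p q l : unit_gradient f -> joins p q l -> f q - f p <= l.
Proof.
move=> hf; elim=> {p q l} [p|c X q l cX _ IH]; first by rewrite subrr.
have /choice[Y hY] : forall t, exists Y, dots Y Y = 1 /\
    deriv_at (fun u => f (c u)) t (dots Y (X t)).
  by move=> t; have [Y Y1 dY] := hf c t (X t) (C1_velocity t cX); exists Y.
have : f (c 1) - f (c 0) <= curve_length X.
  apply: (@increment_le_Rintegral R (fun u => f (c u)) (fun t => dots (Y t) (X t))).
  - by move=> t; case: (hY t).
  - by move=> t; apply: dots_unit_le; case: (hY t).
  - exact: speed_continuous cX.
by lra.
Qed.

Lemma joins_ge0 p q l : joins p q l -> 0 <= l.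
Proof.
elim=> {p q l} // c X q l _ _ IH; rewrite addr_ge0 //.
by apply: Rintegral_ge0 => t _; exact: sqrtr_ge0.
Qed.

Lemma dist_le p q l : joins p q l -> dist p q <= l.
Proof. by move=> h; apply: ge_inf => //; exists 0 => m /joins_ge0. Qed.

Lemma dist_ge f p q l : unit_gradient f -> joins p q l -> f q - f p <= dist p q.
Proof. by move=> hf h; apply: lb_le_inf; [exists l|move=> m /(joins_ge hf)]. Qed.

Lemma curve_length_cst (X : R -> sT G) L :
  (forall t, dots (X t) (X t) = L) -> curve_length X = Num.sqrt L.
Proof.
move=> hX; rewrite /curve_length.
under eq_Rintegral do rewrite hX.
rewrite Rintegral_cst //= lebesgue_measure_itv /= lte01 -EFinB subr0 /= mulr1 //.
Qed.

Definition posexp (a : {posnum R}) (x : R) : {posnum R} := (a%:num * (expRp x)%:num)%:pos.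

(** A vertical line followed at exponential rate has constant velocity L A. *)
Lemma joins_vertical (V : vT G) (Z : zT G) (a b : {posnum R}) q l :
  joins (DamekRicci V Z b) q l ->
  joins (DamekRicci V Z a) q (`|ln b%:num - ln a%:num| + l).
Proof.
set L := ln _ - _ => h.
pose c u := DamekRicci V Z (posexp a (L * u)).
have a0 : DamekRicci V Z a = c 0.
  by congr DamekRicci; apply: val_inj; rewrite /= mulr0 expR0 mulr1.
have b0 : DamekRicci V Z b = c 1.
  congr DamekRicci; apply: val_inj; rewrite /= mulr1 expRB !lnK ?posrE //.
  by rewrite mulrC divfK.
rewrite b0 in h; rewrite a0 -sqrtr_sqr.
rewrite -(@curve_length_cst (fun=> (0, 0, L) : sT G)); last first.
  by move=> t; rewrite dotsE !partE dotvE dotzE; ring.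
apply: joins_cons h; split => [W t|W t|t|W].
- by rewrite /= scaler0 dotvE; exact: deriv_at_cst.
- by rewrite /= brvzE !scaler0 addr0 dotzE; exact: deriv_at_cst.
- apply: deriv_at_eq.
    apply: deriv_at_mul; first exact: deriv_at_cst.
    apply: deriv_at_exp; apply: deriv_at_mul; first exact: deriv_at_cst.
    exact: deriv_at_id.
  by rewrite /=; ring.
- by move=> t; exact: cvg_cst.
Qed.

(** The left translate of the one-parameter group generated by (V, Z): its velocity is
    constant because [V, V] = 0. It is short when a is large compared with V and Z, so
    two fibres approach each other upwards. *)
Lemma joins_horizontal v z (a : {posnum R}) (V : vT G) (Z : zT G) q l :
  joins (DamekRicci (v + V) (z + Z + (1 / 2) *: brvz v V) a) q l ->
  joins (DamekRicci v z a) q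
    (Num.sqrt (dotv V V / a%:num + dotz Z Z / a%:num ^+ 2) + l).
Proof.
pose c u := DamekRicci (v + u *: V) (z + u *: Z + (u / 2) *: brvz v V) a.
have -> : DamekRicci v z a = c 0.
  by rewrite /c mul0r !scale0r !addr0.
have -> : DamekRicci (v + V) (z + Z + (1 / 2) *: brvz v V) a = c 1.
  by rewrite /c !scale1r.
have a0 : a%:num != 0 by [].
have s0 : Num.sqrt a%:num != 0 by rewrite sqrtr_eq0 -ltNge.
have sE : Num.sqrt a%:num ^+ 2 = a%:num by rewrite sqr_sqrtr.
pose X : sT G := ((Num.sqrt a%:num)^-1 *: V, a%:num^-1 *: Z, 0).
rewrite -(@curve_length_cst (fun=> X)); last first.
  move=> t; rewrite /X dotsE !partE !dotvE !dotzE.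
  by move: s0 sE; set s := Num.sqrt _ => s0 <-; field.
apply: joins_cons; split => [W t|W t|t|W].
- rewrite /c /X /= partE scalerA divff // scale1r.
  under eq_fun do rewrite !dotvE.
  apply: deriv_at_eq.
    apply: deriv_at_add; first exact: deriv_at_cst.
    apply: deriv_at_mul; first exact: deriv_at_id.
    exact: deriv_at_cst.
  by ring.
- rewrite /c /X /=.
  under eq_fun do rewrite !dotzE.
  apply: deriv_at_eq.
    apply: deriv_at_add.
      apply: deriv_at_add; first exact: deriv_at_cst.
      apply: deriv_at_mul; first exact: deriv_at_id.
      exact: deriv_at_cst.
    apply: deriv_at_mul; last exact: deriv_at_cst.
    apply: deriv_at_mul; first exact: deriv_at_id.
    exact: deriv_at_cst.
  rewrite !partE !brvzE brvz_alt !dotzE.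
  by field; rewrite s0 a0.
- by rewrite /X partE mulr0; exact: deriv_at_cst.
- by move=> t; exact: cvg_cst.
Qed.

End Length.

(** * Geodesics towards a boundary point *)

Section Geodesic.
Variables (R : realType) (n : vectType R) (G : metricLie2 n).
Variables (J : zT G -> vT G -> vT G) (hJ : generalized_heisenberg J).
Variables (v V : vT G) (z Z : zT G).
Let b : R := dotv V V / 4.
Let k : R := dotz Z Z.

(** The vertical line s |-> (V, Z, s) is sent by the geodesic inversion of the complex
    hyperbolic plane containing it to the curve (geoV s, geoZ s, s / geoD s), which tends
    to (0, 0, 0) as s grows; geo_point translates it so that it tends to (v, z). *)
Definition geoD (s : R) : R := (s + b) ^+ 2 + k.

Lemma geoD_gt0 s : 0 < s -> 0 < geoD s.
Proof.
move=> s0; rewrite /geoD ltr_wpDr ?dotz_ge0 // exprn_gt0 // ltr_wpDr //.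
by rewrite /b divr_ge0 ?dotv_ge0.
Qed.

Definition geoV (s : R) : vT G := - ((s + b) / geoD s) *: V + (geoD s)^-1 *: J Z V.
Definition geoZ (s : R) : zT G := - (geoD s)^-1 *: Z.

Definition geo_height (s : {posnum R}) : {posnum R} :=
  PosNum (divr_gt0 (gt0 s) (geoD_gt0 (gt0 s))).

Definition geo_point (s : {posnum R}) : damek_ricci G :=
  DamekRicci (v + geoV s%:num) (z + geoZ s%:num + (1 / 2) *: brvz v (geoV s%:num))
      (geo_height s).

Lemma brvzVJ : brvz V (J Z V) = (4 * b) *: Z.
Proof. by rewrite (brvzJ hJ) /b mulrC divfK. Qed.

Lemma geoV_norm s : 0 < s -> dotv (geoV s) (geoV s) = 4 * b / geoD s.
Proof.
move=> s0; have D0 := lt0r_neq0 (geoD_gt0 s0).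
rewrite /geoV !dotvE (dotvJJ hJ) !(dotvJl hJ, dotvJr hJ) brvz_alt !dotzE -/k.
have -> : dotv V V = 4 * b by rewrite /b mulrC divfK.
by move: D0; rewrite /geoD => D0; field.
Qed.

Lemma geoZ_norm s : dotz (geoZ s) (geoZ s) = k / geoD s ^+ 2.
Proof. by rewrite /geoZ !dotzE -/k -exprVn; ring. Qed.

Variables (S : {posnum R}) (L : R).
Let c (u : R) := geo_point (posexp S (- L * u)).
Let s (u : R) : R := (posexp S (- L * u))%:num.
Let s0 u : 0 < s u. Proof. by rewrite /s. Qed.
Let D (u : R) : R := geoD (s u).
Let r (u : R) : R := Num.sqrt (s u / D u).

Let ds t : deriv_at s t (- L * s t).
Proof.
apply: deriv_at_eq.
  apply: deriv_at_mul; first exact: deriv_at_cst.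
  apply: deriv_at_exp; apply: deriv_at_mul; first exact: deriv_at_cst.
  exact: deriv_at_id.
by rewrite /s /=; ring.
Qed.

Let D_neq0 u : D u != 0. Proof. exact: lt0r_neq0 (geoD_gt0 (s0 u)). Qed.

Let dD t : deriv_at D t (- 2 * L * s t * (s t + b)).
Proof.
apply: deriv_at_eq.
  apply: deriv_at_add; last exact: deriv_at_cst.
  by apply: deriv_at_mul; (apply: deriv_at_add; [exact: ds|exact: deriv_at_cst]).
by cbv beta; ring.
Qed.

Let da t : deriv_at (fun u => s u / D u) t
  (s t / D t * (- L * (1 - 2 * s t * (s t + b) / D t))).
Proof.
apply: deriv_at_eq.
  apply: deriv_at_mul; first exact: ds.
  by apply: deriv_at_inv; [exact: D_neq0|exact: dD].
by have D0 := D_neq0 t; cbv beta; field.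
Qed.

Let dal t : deriv_at (fun u => (s u + b) / D u) t
  (L * s t * ((s t + b) ^+ 2 - k) / D t ^+ 2).
Proof.
apply: deriv_at_eq.
  apply: deriv_at_mul; first by apply: deriv_at_add; [exact: ds|exact: deriv_at_cst].
  by apply: deriv_at_inv; [exact: D_neq0|exact: dD].
by have := D_neq0 t; rewrite /D /geoD => D0; cbv beta; field.
Qed.

Let dinv t : deriv_at (fun u => (D u)^-1) t (2 * L * s t * (s t + b) / D t ^+ 2).
Proof.
apply: deriv_at_eq.
  by apply: deriv_at_inv; [exact: D_neq0|exact: dD].
by have D0 := D_neq0 t; cbv beta; field.
Qed.

Let r_gt0 u : 0 < r u. Proof. by rewrite sqrtr_gt0 divr_gt0 // geoD_gt0. Qed.
Let rE (u : R) : r u ^+ 2 = s u / D u.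
Proof. by rewrite sqr_sqrtr // divr_ge0 // ltW // geoD_gt0. Qed.

Let X (u : R) : sT G :=
  (- (L * s u * ((s u + b) ^+ 2 - k) / D u ^+ 2 / r u) *: V
     + (2 * L * s u * (s u + b) / D u ^+ 2 / r u) *: J Z V,
   - (2 * L * s u / D u) *: Z,
   - L * (1 - 2 * s u * (s u + b) / D u)).

Let Xsq t : dots (X t) (X t) = L ^+ 2.
Proof.
rewrite dotsE /X !partE !dotvE !dotzE (dotvJJ hJ) !(dotvJl hJ, dotvJr hJ) brvz_alt !dotzE -/k.
have -> : dotv V V = 4 * b by rewrite /b mulrC divfK.
have r0 := lt0r_neq0 (r_gt0 t); have D0 := D_neq0 t.
have st0 := lt0r_neq0 (s0 t).
have kE : k = D t - (s t + b) ^+ 2 by rewrite /D /geoD; ring.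
have sE : s t = r t ^+ 2 * D t by rewrite rE divfK.
by rewrite kE sE; field; rewrite r0 D0.
Qed.

(** Along this curve the parameter is s = S exp (- L u); the field X was obtained by
    solving for the left-translated velocity, and Xsq says that its length is |L|, as for
    the vertical line, which the inversion maps isometrically to it. *)
Lemma geodesic_C1 : C1_curve c X.
Proof.
split => [W t|W t|t|W].
- have r0 := lt0r_neq0 (r_gt0 t).
  rewrite -[Num.sqrt _]/(r t) /c /geo_point /= /geoV.
  under eq_fun do rewrite !dotvE.
  apply: deriv_at_eq.
    apply: deriv_at_add; first exact: deriv_at_cst.
    apply: deriv_at_add.
      apply: deriv_at_mul; last exact: deriv_at_cst.
      by apply: deriv_at_opp; exact: dal.
    apply: deriv_at_mul; last exact: deriv_at_cst.
    exact: dinv.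
  rewrite /X partE !dotvE !mulr0.
  by have D0 := D_neq0 t; cbv beta; field; rewrite r0.
- have r0 := lt0r_neq0 (r_gt0 t).
  rewrite -[Num.sqrt _]/(r t) /c /geo_point /= /geoV /geoZ.

  under eq_fun do rewrite !brvzE !dotzE.
  apply: deriv_at_eq.
    apply: deriv_at_add.
      apply: deriv_at_add; first exact: deriv_at_cst.
      apply: deriv_at_mul; last exact: deriv_at_cst.
      by apply: deriv_at_opp; exact: dinv.
    apply: deriv_at_mul; first exact: deriv_at_cst.
    apply: deriv_at_add.
      apply: deriv_at_mul; last exact: deriv_at_cst.
      by apply: deriv_at_opp; exact: dal.
    apply: deriv_at_mul; last exact: deriv_at_cst.
    exact: dinv.
  rewrite /X !partE !brvzE !brvz_alt [brvz (J Z V) V]brvzC brvzVJ !dotzE.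
  have D0 := D_neq0 t.
  have kE : k = D t - (s t + b) ^+ 2 by rewrite /D /geoD; ring.
  rewrite !mulr0 -[S%:num * expR (- L * t)]/(s t) -/(D t).
  rewrite kE; field.
  by rewrite r0 D0.
- exact: da.
- rewrite /X => t.
  rewrite -[fun _ => _]/(fun u => dotv (vpart W)
      (- (L * s u * ((s u + b) ^+ 2 - k) / D u ^+ 2 / r u) *: V
     + (2 * L * s u * (s u + b) / D u ^+ 2 / r u) *: J Z V)
     + dotz (zpart W) (- (2 * L * s u / D u) *: Z)
     + apart W * (- L * (1 - 2 * s u * (s u + b) / D u))).
  under eq_fun do rewrite !dotvE !dotzE.
  move: t; apply: deriv_at_continuous => t; eexists.
  have dr : deriv_at r t _ := deriv_at_sqrt (f := fun u => s u / D u) (divr_gt0 (s0 t)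
      (geoD_gt0 (s0 t))) (da t).
  have dDr : deriv_at (fun u => (r u)^-1) t _ := deriv_at_inv (f := r) (lt0r_neq0 (r_gt0 t)) dr.
  have dD2 : deriv_at (fun u => (D u ^+ 2)^-1) t _ :=
    deriv_at_inv (f := fun u => D u * D u) (mulf_neq0 (D_neq0 t) (D_neq0 t)) (deriv_at_mul
        (dD t) (dD t)).
  have dsb := deriv_at_add (ds t) (deriv_at_cst b t).
  have dLs := deriv_at_mul (deriv_at_cst L t) (ds t).
  have d2Ls := deriv_at_mul (deriv_at_mul (deriv_at_cst 2 t) (deriv_at_cst L t)) (ds t).
  apply: deriv_at_add.
    apply: deriv_at_add.
      apply: deriv_at_add.
        apply: deriv_at_mul; last exact: deriv_at_cst.
        apply: deriv_at_opp; apply: deriv_at_mul; last exact: dDr.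
        apply: deriv_at_mul; last exact: dD2.
        apply: deriv_at_mul; first exact: dLs.
        apply: deriv_at_add; last exact: deriv_at_cst.
        exact: (deriv_at_mul dsb dsb).
      apply: deriv_at_mul; last exact: deriv_at_cst.
      apply: deriv_at_mul; last exact: dDr.
      apply: deriv_at_mul; last exact: dD2.
      by apply: deriv_at_mul; [exact: d2Ls|exact: dsb].
    apply: deriv_at_mul; last exact: deriv_at_cst.
    apply: deriv_at_opp; apply: deriv_at_mul; first exact: d2Ls.
    exact: dinv.
  apply: deriv_at_mul; first exact: deriv_at_cst.
  apply: deriv_at_mul; first exact: deriv_at_cst.
  apply: deriv_at_add; first exact: deriv_at_cst.
  apply: deriv_at_opp; apply: deriv_at_mul; last exact: dinv.
  apply: deriv_at_mul; last exact: dsb.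
  by apply: deriv_at_mul; [exact: deriv_at_cst|exact: ds].
Qed.

Lemma joins_geodesic q l : joins (c 1) q l -> joins (c 0) q (`|L| + l).
Proof.
move=> h; rewrite -sqrtr_sqr -(@curve_length_cst _ _ _ X _ Xsq).
exact: joins_cons geodesic_C1 h.
Qed.

End Geodesic.

(** * Computation of the Busemann functions *)

Section Busemann.
Variables (R : realType) (n : vectType R) (G : metricLie2 n).
Implicit Types (p q : damek_ricci G) (X Y : sT G).

(** A squeeze: f bounds the distance from below because it is 1-Lipschitz, and explicit
    curves whose excess length tends to 0 bound it from above. *)
Lemma busemann_rayE (f : damek_ricci G -> R) (gamma : R -> damek_ricci G)
    (eps : R -> R) (T : R) q :
  unit_gradient f -> (forall t, f (gamma t) = - t) ->
  eps t @[t --> +oo] --> 0 ->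
  (forall t, T <= t -> joins (gamma t) q (t + f q + eps t)) ->
  busemann_ray gamma q = f q.
Proof.
move=> hf fg e0 hj; apply: cvg_lim; first exact: Rhausdorff.
apply: (squeeze_cvgr (f := fun=> f q) (h := fun t => f q + eps t)).
- near=> t; have Tt : T <= t by near: t; apply: nbhs_pinfty_ge; rewrite num_real.
  have := dist_ge hf (hj t Tt); have := dist_le (hj t Tt); rewrite fg => h1 h2.
  by apply/andP; split; lra.
- exact: cvg_cst.
- by rewrite -[X in _ --> X]addr0; apply: cvgD => //; exact: cvg_cst.
Unshelve. all: by end_near.
Qed.

Lemma horizontal_cvg0 (x y : R) :
  Num.sqrt (x * expR (- t) + y * expR (- t) ^+ 2) @[t --> +oo] --> (0 : R).
Proof.
rewrite -[X in _ --> X](sqrtr0 R); apply: continuous_cvg; first exact: sqrt_continuous.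
rewrite -[X in _ --> X](_ : x * 0 + y * (0 * 0) = 0); last by rewrite !mulr0 addr0.
by apply: cvgD; apply: cvgM; [exact: cvg_cst|exact: cvgr_expR|exact: cvg_cst|
   apply: cvgM; exact: cvgr_expR].
Qed.

(** The path from (0, 0, e^t) first moves horizontally at that height, at a cost that
    tends to 0, and then goes straight down to q. *)
Lemma busemann_rayE_oo q : busemann_ray (@ray R n G None) q = - ln (ca q)%:num.
Proof.
apply: (@busemann_rayE (fun p => - ln (ca p)%:num) _
  (fun t => Num.sqrt (dotv (cV q) (cV q) * expR (- t)
     + dotz (cZ q) (cZ q) * expR (- t) ^+ 2)) (ln (ca q)%:num)).
- by move=> c t X h; exists (- vecA G);
    [rewrite dotsNl dotsNr opprK dots_vecA|exact: height_derive].
- by move=> t; rewrite /= expRK.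
- exact: horizontal_cvg0.
- move=> t tq.
  have -> : t + - ln (ca q)%:num = `|ln (ca q)%:num - ln (expRp t)%:num| + 0.
    by rewrite expRK addr0 distrC ger0_norm // subr_ge0.
  rewrite addrC; set d := `|_| + 0.
  have -> : dotv (cV q) (cV q) * expR (- t) = dotv (cV q) (cV q) / (expRp t)%:num.
    by rewrite expRN.
  have -> : dotz (cZ q) (cZ q) * expR (- t) ^+ 2 = dotz (cZ q) (cZ q) / (expRp t)%:num ^+ 2.
    by rewrite expRN exprVn.
  apply: joins_horizontal.
  rewrite brvz0l scaler0 !add0r addr0; apply: joins_vertical.
  by case: q {tq d} => *; exact: joins_nil.
Qed.

Variables (J : zT G -> vT G -> vT G) (hJ : generalized_heisenberg J).

(** The inversion is an involution, so the vertical line to start from is the one through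
    the inverse of (V0, Z0, a). *)
Lemma geodesic_through (V0 : vT G) (Z0 : zT G) (a : {posnum R}) :
  exists V Z (s : {posnum R}),
  [/\ geoV J V Z s%:num = V0, geoZ V Z s%:num = Z0, geo_height V Z s = a &
      s%:num = a%:num / busF (V0, Z0, a%:num)].
Proof.
pose x : sT G := (V0, Z0, a%:num).
have x0 : 0 < apart x by rewrite /x partE.
have F0 := busF_gt0 x0; have F1 := lt0r_neq0 F0.
(* The coordinates of the inverse of (V0, Z0, a). *)
pose V := (busF x)^-1 *: (J Z0 V0 - busE x *: V0); pose Z := - (busF x)^-1 *: Z0.
pose s : {posnum R} := PosNum (divr_gt0 x0 F0).
have FE : dotz Z0 Z0 = busF x - busE x ^+ 2 by rewrite /busF /x !partE; ring.
have aE : apart x = busE x - dotv V0 V0 / 4 by rewrite /busE partE; ring.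
have VV : dotv V V = dotv V0 V0 / busF x.
  rewrite /V !dotvE (dotvJJ hJ) !(dotvJl hJ, dotvJr hJ) brvz_alt !dotzE.
  by rewrite FE; field.
have sb : s%:num + dotv V V / 4 = busE x / busF x.
  have es : s%:num = apart x / busF x by [].
  by rewrite VV es aE; field.
have Ds : geoD V Z s%:num = (busF x)^-1.
  by rewrite /geoD sb /Z !dotzE FE; field.
exists V, Z, s; split => //.
- apply: dotvP => W; rewrite /geoV Ds sb invrK /V /Z.
  rewrite !(JE hJ) (JJ hJ) !dotvE FE.
  by field.
- by rewrite /geoZ Ds invrK /Z scalerA mulrNN divff // scale1r.
- by apply: val_inj; rewrite /= Ds invrK divfK.
Qed.

(** Every point q lies on a geodesic ending at (v, z), and its parameter s there is
    the exponential of minus the Busemann function. *)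
Lemma geo_point_onto v z q : exists V Z (s : {posnum R}),
  geo_point J v V z Z s = q /\ bus v z q = - ln s%:num.
Proof.
have [V [Z [s [eV eZ ea es]]]] :=
  geodesic_through (cV q - v) (cZ q - z - (1 / 2) *: brvz v (cV q - v)) (ca q).
exists V, Z, s; split.
  rewrite /geo_point eV eZ ea; case: q {eV eZ ea es} => qV qZ qa /=; congr DamekRicci.
  - by rewrite addrC subrK.
  - by rewrite -addrA subrK addrC subrK.
have F0 := busF_gt0 (relpos_gt0 v z q).
have -> : s%:num = (ca q)%:num / busF (relpos v z q).
  rewrite es; congr (_ / _); rewrite /relpos /busF /busE !partE.
  rewrite -[cV q - v]opprB.
  have -> : cZ q - z - (1 / 2) *: brvz v (- (v - cV q))
      = - (z - cZ q - (1 / 2) *: brvz (cV q) v).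
    rewrite opprB brvzDr brvzNr brvz_alt subr0 [brvz v _]brvzC scalerN.
    by rewrite !opprD !opprK [cZ q - z]addrC.
  by rewrite dotvNl dotvNr dotzNl dotzNr !opprK.
by rewrite /bus ln_div ?posrE // opprB.
Qed.

(** The path from (v, z, e^-t) adjusts its height, moves horizontally onto the geodesic
    through q that ends at (v, z), and follows it back to q. The first two pieces have
    lengths that tend to 0. *)
Lemma busemann_rayE_pt v z q : busemann_ray (ray (Some (v, z))) q = bus v z q.
Proof.
have [V [Z [s [sq bs]]]] := geo_point_onto v z q.
pose b := dotv V V / 4; pose k := dotz Z Z.
(* With h = exp (- t), the height s / geoD s of the geodesic at s = exp t is h / m h. *)
pose m h := (1 + b * h) ^+ 2 + k * h ^+ 2.
have m0 h : 0 <= h -> 0 < m h.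
  move=> h0; rewrite /m ltr_wpDr ?mulr_ge0 ?dotz_ge0 ?exprn_ge0 // exprn_gt0 //.
  by rewrite ltr_wpDr // mulr_ge0 // divr_ge0 // dotv_ge0.
apply: (@busemann_rayE (bus v z) _
  (fun t => `|- ln (m (expR (- t)))| + Num.sqrt (4 * b * expR (- t) + k * expR (- t) ^+ 2))
  (ln s%:num)).
- move=> c t X h; exists (grad_bus J (relpos v z (c t))); last exact: bus_derive.
  by apply: grad_bus_unit => //; exact: relpos_gt0.
- move=> t; rewrite /bus /relpos /busF /busE !partE /= !subrr brvz_alt scaler0 subr0.
  rewrite dotv0l dotz0l mul0r !addr0 lnXn ?expR_gt0 // expRK mulr2n; lra.
- rewrite -[X in _ --> X]addr0; apply: cvgD; last exact: horizontal_cvg0.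
  rewrite -[X in _ --> X](_ : `|- ln (m 0)| = 0); last first.
    by rewrite /m !mulr0 expr0n mulr0 !addr0 expr1n ln1 oppr0 normr0.
  apply: cvg_norm; apply: cvgN; apply: continuous_cvg.
    by apply: continuous_ln; exact: m0.
  rewrite /m; apply: cvgD.
    by apply: cvgM; (apply: cvgD; [exact: cvg_cst|apply: cvgM; [exact: cvg_cst|exact:
        cvgr_expR]]).
  by apply: cvgM; [exact: cvg_cst|apply: cvgM; exact: cvgr_expR].
- move=> t tq; rewrite bs /=.
  pose S := expRp t.
  have S0 : S%:num != 0 by [].
  have hE : expR (- t) = (S%:num)^-1 by rewrite expRN.
  have mD : m (expR (- t)) = geoD V Z S%:num / S%:num ^+ 2.
    by rewrite hE /m /geoD -/b -/k; field.
  have D0 := lt0r_neq0 (geoD_gt0 V Z (gt0 S)).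
  have gaE : (geo_height V Z S)%:num = S%:num / geoD V Z S%:num by [].
  have -> : t + - ln s%:num + (`|- ln (m (expR (- t)))| + Num.sqrt (4 * b * expR (- t) + k *
      expR (- t) ^+ 2))
     = `|ln (geo_height V Z S)%:num - ln (expRp (- t))%:num|
      + (Num.sqrt (dotv (geoV J V Z S%:num) (geoV J V Z S%:num) / (geo_height V Z S)%:num
           + dotz (geoZ V Z S%:num) (geoZ V Z S%:num) / (geo_height V Z S)%:num ^+ 2)
      + (`|t - ln s%:num| + 0)).
    rewrite (geoV_norm hJ) // geoZ_norm -/b -/k mD hE.
    rewrite [`|t - _|]ger0_norm ?subr_ge0 // addr0 addrC -addrA; congr (`|_| + (Num.sqrt _ +
        _)).
      have e0 := expR_gt0 t; have D1 := geoD_gt0 V Z e0; have e2 := exprn_gt0 2 e0.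
      rewrite expRK /= ln_div ?posrE // ln_div ?posrE //.
      by rewrite lnXn ?expR_gt0 // expRK mulr2n; ring.
    by rewrite gaE; field; rewrite S0 D0.
  apply: joins_vertical; apply: joins_horizontal.
  have -> : DamekRicci (v + geoV J V Z S%:num)
     (z + geoZ V Z S%:num + (1 / 2) *: brvz v (geoV J V Z S%:num)) (geo_height V Z S) =
     geo_point J v V z Z (posexp S (- (t - ln s%:num) * 0)).
    have -> : posexp S (- (t - ln s%:num) * 0) = S; last by [].
    by apply: val_inj; rewrite /= mulr0 expR0 mulr1.
  apply: joins_geodesic => //.
  have -> : posexp S (- (t - ln s%:num) * 1) = s.
    apply: val_inj; rewrite /= mulr1 -expRD opprB addrC subrK lnK //.
    by rewrite posrE.
  by rewrite sq; exact: joins_nil.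
Qed.

Lemma busemann_oo : busemann None = fun q : damek_ricci G => - ln (ca q)%:num.
Proof.
by apply/funext => q; rewrite /busemann !busemann_rayE_oo /= ln1 oppr0 subr0.
Qed.

Lemma busemann_pt v z : busemann (Some (v, z)) = fun q : damek_ricci G => bus v z q - bus v
    z (oneS G).
Proof. by apply/funext => q; rewrite /busemann !busemann_rayE_pt. Qed.

End Busemann.

(** * The Hessian *)

Section RieszEnd.
Variables (R : realType) (T : vectType R) (d : {dot T for idfun}).

Lemma riesz_endomorphism (b : T -> T -> R) :
  (forall y, linear_for *%R (b^~ y)) -> (forall x, linear_for *%R (b x)) ->
  exists H : 'End(T), forall x y, d (H x) y = b x y.
Proof.
move=> bl br; have [w hw] := dual_basis d.
pose h x := \sum_(i < \dim {:T}) b x (vbasis {:T})`_i *: w i.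
have lh : linear h.
  move=> a u v; rewrite /h scaler_sumr -big_split; apply: eq_bigr => i _.
  by rewrite bl scalerDl scalerA.
pose hL : {linear T -> T} := HB.pack h (GRing.isLinear.Build R T T *:%R h lh).
exists (linfun hL) => x y; rewrite lfunE /= /h linear_sumlz.
pose phi : {linear T -> R^o} :=
  HB.pack (b x : T -> R^o) (GRing.isLinear.Build R T R^o *:%R (b x) (br x)).
rewrite -[RHS]/(phi y) [in RHS](hw y) linear_sum; apply: eq_bigr => i _.
by rewrite linearZl_LR linearZ mulrC.
Qed.

End RieszEnd.

Section Hessian.
Variables (R : realType) (n : vectType R) (G : metricLie2 n).
Variables (J : zT G -> vT G -> vT G) (hJ : generalized_heisenberg J).
Implicit Types (p q : damek_ricci G) (x X Y : sT G).

(** The solution of the Koszul formula for left-invariant fields. *)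
Definition lc_nabla X Y : sT G :=
  (- (1 / 2) *: J (zpart Y) (vpart X) - (1 / 2) *: J (zpart X) (vpart Y)
     - (apart Y / 2) *: vpart X,
   - (1 / 2) *: brvz (vpart Y) (vpart X) - apart Y *: zpart X,
   dotv (vpart X) (vpart Y) / 2 + dotz (zpart X) (zpart Y)).

Lemma sT_eq X Y : vpart X = vpart Y -> zpart X = zpart Y -> apart X = apart Y -> X = Y.
Proof. by case: X => -[? ?] ?; case: Y => -[? ?] ?; rewrite !partE => -> -> ->. Qed.

Lemma levi_civita_lc_nabla : levi_civita lc_nabla.
Proof.
split => [X Y|X Y W].
  apply: sT_eq.
  - rewrite -[vpart (_ - _)]/(vpart (lc_nabla X Y) - vpart (lc_nabla Y X)) /lc_nabla /brs
      !partE.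
    by apply: dotvP => W; rewrite !dotvE; field.
  - rewrite -[zpart (_ - _)]/(zpart (lc_nabla X Y) - zpart (lc_nabla Y X)) /lc_nabla /brs
      !partE.
    by apply: dotzP => W; rewrite [brvz (vpart Y) _]brvzC !dotzE; field.
  - transitivity (apart (lc_nabla X Y) - apart (lc_nabla Y X)) => //; rewrite /lc_nabla /brs
      !partE.
    by rewrite dotvC dotzC; ring.
rewrite !dotsE /lc_nabla !partE !dotvE !dotzE !(dotvJl hJ, dotvJr hJ).
rewrite [dotv (vpart Y) (vpart X)]dotvC [dotz (zpart Y) (zpart X)]dotzC.
rewrite [dotz (zpart Y) (brvz _ _)]dotzC [brvz (vpart W) (vpart X)]brvzC.
rewrite [brvz (vpart Y) (vpart X)]brvzC [brvz (vpart W) (vpart Y)]brvzC !dotzE.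
rewrite [dotz _ (zpart W)]dotzC [dotz _ (zpart Y)]dotzC.
by field.
Qed.

Lemma lmove0 X p : lmove X p 0 = p.
Proof.
case: p => V Z a; rewrite /lmove /mulS /= !scale0r scaler0 brvz0r !scaler0 !addr0.
by congr DamekRicci; apply: val_inj; rewrite /= mul0r expR0 mulr1.
Qed.

Lemma lmove_velocity X p : has_velocity (lmove X p) 0 X.
Proof.
rewrite /has_velocity lmove0; split => [W|W|].
- rewrite /lmove /mulS /=; under eq_fun do rewrite !dotvE.
  apply: deriv_at_eq.
    apply: deriv_at_add; first exact: deriv_at_cst.
    apply: deriv_at_mul; first exact: deriv_at_cst.
    apply: deriv_at_mul; last exact: deriv_at_cst.
    exact: deriv_at_id.
  by rewrite !dotvE; ring.
- rewrite /lmove /mulS /=; under eq_fun do rewrite !brvzE !dotzE.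
  apply: deriv_at_eq.
    apply: deriv_at_add.
      apply: deriv_at_add; first exact: deriv_at_cst.
      apply: deriv_at_mul; first exact: deriv_at_cst.
      apply: deriv_at_mul; last exact: deriv_at_cst.
      exact: deriv_at_id.
    apply: deriv_at_mul; first exact: deriv_at_cst.
    apply: deriv_at_mul; last exact: deriv_at_cst.
    exact: deriv_at_id.
  by rewrite !dotzE; ring.
- rewrite /lmove /mulS /=; apply: deriv_at_eq.
    apply: deriv_at_mul; first exact: deriv_at_cst.
    apply: deriv_at_exp; apply: deriv_at_mul; last exact: deriv_at_cst.
    exact: deriv_at_id.
  by rewrite /= !mul0r expR0; ring.
Qed.

Lemma deriv_at_derive1 (f : R -> R) t d : deriv_at f t d -> derivable f t 1 /\ derive1 f t = d.
Proof. by move=> [fd <-]; rewrite derive1E. Qed.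

Lemma is_hessianP (f : damek_ricci G -> R) (df : sT G -> damek_ricci G -> R) p (H : 'End(sT G))
    (d2f : sT G -> sT G -> R) :
  (forall X q, deriv_at (fun t => f (lmove X q t)) 0 (df X q)) ->
  (forall X Y, deriv_at (fun t => df Y (lmove X p t)) 0 (d2f X Y)) ->
  (forall X Y, dots (H X) Y = d2f X Y - df (lc_nabla X Y) p) ->
  is_hessian f p H.
Proof.
move=> h1 h2 h3.
have lE Y : lderiv Y f = df Y.
  by apply/funext => q; rewrite /lderiv; case: (deriv_at_derive1 (h1 Y q)).
exists lc_nabla; split => [|X q|X Y|X Y].
- exact: levi_civita_lc_nabla.
- by case: (h1 X q).
- by rewrite lE; case: (h2 X Y).
- by rewrite !lE h3 /lderiv; case: (deriv_at_derive1 (h2 X Y)) => _ ->.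
Qed.

(** The gradient of - log a is the left-invariant field - A, and - nabla A is one half on v,
    one on z and zero on A. *)
Definition hess_oo X Y : R :=
  dotv (vpart X) (vpart Y) / 2 + dotz (zpart X) (zpart Y).

Lemma hess_ooC X Y : hess_oo X Y = hess_oo Y X.
Proof. by rewrite /hess_oo dotvC dotzC. Qed.

Lemma hess_oo_linear Y : linear_for *%R (hess_oo^~ Y).
Proof. by move=> a u w; rewrite /hess_oo !sT_partD !dotvE !dotzE; ring. Qed.

Lemma hessian_oo p : exists2 H : 'End(sT G), is_hessian (busemann None) p H &
  forall X Y, dots (H X) Y = hess_oo X Y.
Proof.
have [H hH] : exists H : 'End(sT G), forall X Y, dotS G (H X) Y = hess_oo X Y.
  apply: riesz_endomorphism => [|X a Y W]; first exact: hess_oo_linear.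
  by rewrite hess_ooC hess_oo_linear ![hess_oo _ X]hess_ooC.
exists H => //.
apply: (@is_hessianP _ (fun Y _ => - apart Y) _ _ (fun _ _ => 0)) => [X q|X Y|X Y].
- rewrite busemann_oo.
  apply: deriv_at_eq; first exact: height_derive (lmove_velocity X q).
  by rewrite dotsNl dots_vecA.
- exact: deriv_at_cst.
- by rewrite [LHS]hH /lc_nabla !partE /hess_oo opprK add0r.
Qed.

(** The Hessian of busF in a manifestly symmetric form; hess_busF_nabla identifies it. *)
Definition hess_busF x X Y : R :=
  let a := apart x in let s := Num.sqrt a in let E := busE x in
  let V := vpart x in let Z := zpart x in
  s / 2 * (apart X * (dotz Z (brvz V (vpart Y)) - E * dotv V (vpart Y))
         + apart Y * (dotz Z (brvz V (vpart X)) - E * dotv V (vpart X)))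
  - a * s * (apart X * dotv V (vpart Y) + apart Y * dotv V (vpart X))
  + s * (E / 2 - a) * (dotz (zpart X) (brvz V (vpart Y)) + dotz (zpart Y) (brvz V (vpart X)))
  - s / 2 * (dotz (zpart X) (brvz (J Z V) (vpart Y)) + dotz (zpart Y) (brvz (J Z V) (vpart X)))
  + a / 2 * (dotz (brvz V (vpart X)) (brvz V (vpart Y)) + dotv V (vpart X) * dotv V (vpart Y))
  - 2 * a * (apart X * dotz Z (zpart Y) + apart Y * dotz Z (zpart X))
  + 2 * a * (a - E) * dotz (zpart X) (zpart Y)
  + 2 * a * (E + a) * apart X * apart Y.

(** The Hessian of log busF - log a: the Hessian of busF over F, minus the square of
    the differential of log busF, plus the Hessian of - log a. *)
Definition hess_bus x X Y : R :=
  hess_busF x X Y / busF x - dbusF x X * dbusF x Y / busF x ^+ 2 + hess_oo X Y.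

Lemma hess_busFC x X Y : hess_busF x X Y = hess_busF x Y X.
Proof.
rewrite /hess_busF [dotz (zpart X) (zpart Y)]dotzC [dotz (brvz (vpart x) (vpart X)) _]dotzC.
by ring.
Qed.

Lemma hess_busC x X Y : hess_bus x X Y = hess_bus x Y X.
Proof. by rewrite /hess_bus hess_busFC hess_ooC [dbusF x X * _]mulrC. Qed.

Lemma dbusF_linear x : linear_for *%R (dbusF x).
Proof. by move=> a u w; rewrite /dbusF !sT_partD !brvzE !dotvE !dotzE; ring. Qed.

Lemma hess_busF_linear x Y : linear_for *%R ((hess_busF x)^~ Y).
Proof. by move=> a u w; rewrite /hess_busF !sT_partD !brvzE !dotvE !dotzE; ring. Qed.

Lemma hess_bus_linear x Y : linear_for *%R ((hess_bus x)^~ Y).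
Proof. by move=> a u w; rewrite /hess_bus hess_busF_linear hess_oo_linear dbusF_linear;
    ring. Qed.

(** Both sides are <J_Z V, J_Y U>. *)
Lemma dotz_brvzJ (Y Z : zT G) (U V : vT G) : dotz Z (brvz V (J Y U)) = - dotz Y (brvz (J Z
    V) U).
Proof. by rewrite -(dotvJl hJ) (dotvJr hJ) brvzC dotzE. Qed.

Lemma hess_busF_nabla x X Y : 0 < apart x -> d2busF x X Y - dbusF x (lc_nabla X Y) =
    hess_busF x X Y.
Proof.
move=> x0; rewrite /d2busF /dbusF /lc_nabla !partE !brvzE !dotzE !dotvE !dotz_brvzJ.
rewrite !(dotvJr hJ) [brvz (vpart X) (vpart x)]brvzC [brvz (vpart Y) (vpart x)]brvzC.
rewrite [brvz (vpart Y) (vpart X)]brvzC !dotzE [dotz (brvz (vpart x) (vpart X)) (zpart Y)]dotzC.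
rewrite /hess_busF [dotz (zpart X) (zpart Y)]dotzC.
have := sqr_sqrtr (ltW x0); set s := Num.sqrt _ => sE.
by rewrite -sE; field.
Qed.

Lemma hessian_pt v z p : exists2 H : 'End(sT G), is_hessian (busemann (Some (v, z))) p H &
  forall X Y, dots (H X) Y = hess_bus (relpos v z p) X Y.
Proof.
set x := relpos v z p; have x0 : 0 < apart x := relpos_gt0 v z p.
have [H hH] : exists H : 'End(sT G), forall X Y, dotS G (H X) Y = hess_bus x X Y.
  apply: riesz_endomorphism => [|X a Y W]; first exact: hess_bus_linear.
  by rewrite hess_busC hess_bus_linear ![hess_bus x _ X]hess_busC.
exists H => //.
pose df Y q := dbusF (relpos v z q) Y / busF (relpos v z q) - apart Y.
apply: (@is_hessianP _ df _ _ (fun X Y => d2busF x X Y / busF x - dbusF x X * dbusF x Y /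
    busF x ^+ 2)) => [X q|X Y|X Y].
- rewrite (busemann_pt hJ).
  apply: deriv_at_eq.
    apply: deriv_at_add; last exact: deriv_at_cst.
    exact: bus_derive hJ v z _ _ _ (lmove_velocity X q).
  by rewrite lmove0 (dots_grad_bus hJ) ?relpos_gt0 // addr0.
- have hv := lmove_velocity X p.
  have dx := relpos_derive hJ v z hv.
  apply: deriv_at_eq.
    apply: deriv_at_add; last exact: deriv_at_cst.
    apply: deriv_at_mul; first by apply: (dbusF_derive dx); exact: relpos_gt0.
    by apply: deriv_at_inv; [rewrite lt0r_neq0 // busF_gt0 // relpos_gt0 | exact:
        busF_derive dx].
  cbv beta; rewrite lmove0 -/x; have F0 := lt0r_neq0 (busF_gt0 x0); by field.
- rewrite [LHS]hH /hess_bus -hess_busF_nabla // /df -/x /lc_nabla !partE.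
  by rewrite /hess_oo; ring.
Qed.

End Hessian.

(** * A normal form that determines the spectrum *)

Lemma scale_half_double (R : realType) (V : lmodType R) (x : V) :
  (1 / 2) *: (x + x) = x.
Proof.
rewrite -[in LHS](scale1r x) -scalerDl scalerA (_ : 1 / 2 * (1 + 1) = 1) ?scale1r //.
by field.
Qed.

Section Spectrum.
Variables (R : realType) (T T' : vectType R) (H : 'End(T)) (U : {vspace T}).
Variables (g : {linear T -> R^o}) (w : T) (e : {linear T' -> T}) (es : {linear T -> T'}).
Hypotheses (wU : w \in U) (eU : forall y, e y \in U).
Hypotheses (gw : g w = 1) (ge : forall y, g (e y) = 0).
Hypotheses (esw : es w = 0) (ese : forall y, es (e y) = y).
Hypothesis HE : forall x, x \in U -> H x = (1 / 2) *: (x - g x *: w + e (es x)).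

Lemma mem_leigenspace a x : (x \in passmx.leigenspace H a) = (H x == a *: x).
Proof.
by rewrite memv_ker add_lfunE opp_lfunE scale_lfunE id_lfunE subr_eq0.
Qed.

Let gH x : x \in U -> g (H x) = 0.
Proof.
move=> xU; rewrite HE // linearZ linearD linearB linearZ /= gw ge.
by rewrite -[_ *: 1]/(_ * 1) mulr1 subrr addr0 scaler0.
Qed.

Let esH x : x \in U -> es (H x) = es x.
Proof.
move=> xU; rewrite HE // linearZ linearD linearB linearZ /= esw ese.
by rewrite scaler0 subr0 scale_half_double.
Qed.

Let phi x : (R^o * T')%type := (g x, es x).
Let phi_linear : linear phi.
Proof. by move=> a x y; rewrite /phi !linearP. Qed.
Let phiL : {linear T -> (R^o * T')%type} :=
  HB.pack phi (GRing.isLinear.Build R T (R^o * T')%type *:%R phi phi_linear).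

Lemma eigen0 x : x \in U -> H x = 0 <-> x \in <[w]>%VS.
Proof.
move=> xU; split=> [Hx|/vlineP[a ->]].
  have ex0 : es x = 0 by rewrite -esH // Hx linear0.
  move: Hx; rewrite HE // ex0 linear0 addr0 => /eqP.
  rewrite scaler_eq0 mul1r invr_eq0 pnatr_eq0 /= subr_eq0 => /eqP ->.
  by apply/vlineP; exists (g x).
rewrite HE ?rpredZ // [g _]linearZ [es _]linearZ /= gw esw scaler0 linear0 addr0.
by rewrite -[_ *: 1]/(_ * 1) mulr1 subrr scaler0.
Qed.

Lemma eigen1 x : x \in U -> H x = x <-> x \in limg (linfun e).
Proof.
move=> xU; split=> [Hx|/memv_imgP[y _ ->]].
  have gx0 : g x = 0 by rewrite -Hx gH.
  move: Hx; rewrite HE // gx0 scale0r subr0 => Hx.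
  have -> : x = e (es x).
    by apply/esym/(addrI x); rewrite -[LHS]scale_half_double scalerDr Hx.
  by rewrite -[e _](lfunE e); apply: memv_img; exact: memvf.
by rewrite lfunE /= HE // ge scale0r subr0 ese scale_half_double.
Qed.

Lemma eigen_half x : x \in U -> H x = (1 / 2) *: x <-> phi x = 0.
Proof.
move=> xU; split=> [Hx|[gx ex]].
  have g0 : g x = 0.
    apply/eqP; have := gH xU; rewrite Hx linearZ /= => /eqP.
    by rewrite scaler_eq0 mul1r invr_eq0 pnatr_eq0.
  have e0 : es x = 0.
    have := esH xU; rewrite Hx linearZ /= => /eqP.
    rewrite -subr_eq0 -{2}[es x]scale1r -scalerBl scaler_eq0 => /orP[|/eqP //].
    by rewrite (_ : 1 / 2 - 1 = - (1 / 2)) ?oppr_eq0 ?mul1r ?invr_eq0 ?pnatr_eq0 //; field.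
  by rewrite /phi g0 e0.
by rewrite HE // gx ex linear0 scale0r subr0 addr0.
Qed.

Lemma eigen_only x a : x \in U -> x != 0 -> H x = a *: x -> a \in [:: 0; 1 / 2; 1].
Proof.
move=> xU x0 Hx; rewrite !inE; apply: contraT; rewrite !negb_or => /and3P[a0 ah a1].
have g0 : g x = 0.
  apply/eqP; have := gH xU; rewrite Hx linearZ /= => /eqP.
  by rewrite scaler_eq0 (negPf a0).
have e0 : es x = 0.
  have := esH xU; rewrite Hx linearZ /= => /eqP.
  by rewrite -subr_eq0 -{2}[es x]scale1r -scalerBl scaler_eq0 subr_eq0 (negPf a1) => /eqP.
have /eqP : H x = (1 / 2) *: x by apply/eigen_half => //; rewrite /phi g0 e0.
by rewrite Hx -subr_eq0 -scalerBl scaler_eq0 subr_eq0 (negPf ah) (negPf x0).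
Qed.

Lemma dim_half : (\dim (U :&: passmx.leigenspace H (1 / 2)) + (1 + dim T') = \dim U)%N.
Proof.
have -> : (U :&: passmx.leigenspace H (1 / 2))%VS = (U :&: lker (linfun phiL))%VS.
  apply/vspaceP => x; rewrite !memv_cap; case xU: (x \in U) => //=.
  rewrite mem_leigenspace memv_ker (lfunE phiL).
  by apply/eqP/eqP => h; apply/eigen_half.
rewrite -(limg_ker_dim (linfun phiL) U); congr addn.
have -> : (linfun phiL @: U)%VS = fullv.
  apply/eqP; rewrite eqEsubv subvf /=; apply/subvP => -[a y] _.
  have -> : (a, y) = linfun phiL (a *: w + e y).
    rewrite (lfunE phiL) -[RHS]/(g (a *: w + e y), es (a *: w + e y)) !linearP gw esw ge ese
        scaler0 add0r addr0.
    by rewrite -[_ *: 1]/(_ * 1) mulr1.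
  by apply: memv_img; rewrite rpredD // rpredZ.
by rewrite dimvf /dim /=.
Qed.

(** The kernel of H on U is the line of w, the eigenspace of 1 is the image of e, and that
    of 1 / 2 is the common kernel of g and es, whose dimension follows by counting. Any
    other eigenvector would be annihilated by g and es, hence belong to 1 / 2. *)
Lemma split_spectrum k : (0 < k)%N -> (0 < dim T')%N -> (\dim U = k + (1 + dim T'))%N ->
  has_spectrum H U [:: (0, 1%N); (1 / 2, k); (1, dim T')].
Proof.
move=> k0 T0 dU.
have w0 : w != 0 by apply: contra_eq_neq gw => ->; rewrite linear0 eq_sym oner_neq0.
have dk : \dim (U :&: passmx.leigenspace H (1 / 2)) = k.
  by apply/eqP; rewrite -(eqn_add2r (1 + dim T')) dim_half dU.
have d1 : \dim (U :&: passmx.leigenspace H 1) = dim T'.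
  have -> : (U :&: passmx.leigenspace H 1)%VS = limg (linfun e).
    apply/vspaceP => x; rewrite memv_cap; case xU: (x \in U) => /=.
      rewrite mem_leigenspace scale1r; apply/eqP/idP => h; exact/eigen1.
    apply/esym/negbTE; apply: contraFN xU => /memv_imgP[y _ ->].
    by rewrite lfunE /= eU.
  rewrite limg_dim_eq ?dimvf //; apply/eqP; rewrite -subv0; apply/subvP => y.
  rewrite memv_cap memvf memv_ker lfunE /= => /eqP ey.
  by rewrite -(ese y) ey linear0 mem0v.
have d0 : \dim (U :&: passmx.leigenspace H 0) = 1%N.
  have -> : (U :&: passmx.leigenspace H 0)%VS = <[w]>%VS.
    apply/vspaceP => x; rewrite memv_cap; case xU: (x \in U) => /=.
      rewrite mem_leigenspace scale0r; apply/eqP/idP => h; exact/eigen0.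
    apply/esym/negbTE; apply: contraFN xU => /vlineP[a ->].
    by rewrite rpredZ.
  by rewrite dim_vline w0.
have ex a d : (0 < d)%N -> \dim (U :&: passmx.leigenspace H a) = d -> eigenvalue_on H [set`
    U] a.
  move=> d0' da; have V0 : (U :&: passmx.leigenspace H a)%VS != 0%VS by rewrite -dimv_eq0 da
      -lt0n.
  exists (vpick (U :&: passmx.leigenspace H a)).
  have := memv_pick (U :&: passmx.leigenspace H a); rewrite memv_cap mem_leigenspace =>
      /andP[h1 /eqP h2].
  by split => //; rewrite vpick0.
split.
- apply/subvP => _ /memv_imgP[x xU ->]; rewrite HE // rpredZ // rpredD // rpredB // rpredZ //.
- by move=> a d; rewrite !inE => /or3P[] /eqP[-> ->].
- move=> a /=; split => [[x [xU x0 Hx]]|]; first exact: eigen_only xU x0 Hx.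
  by rewrite !inE => /or3P[] /eqP ->; [apply: ex d0|apply: ex dk|apply: ex d1].
Qed.

End Spectrum.

(** * The spectrum on the whole tangent space *)

Section HessianSpectrum.
Variables (R : realType) (n : vectType R) (G : metricLie2 n).
Variables (J : zT G -> vT G -> vT G) (hJ : generalized_heisenberg J).
Implicit Types (p q : damek_ricci G) (x X Y W : sT G).

Lemma dotsP X Y : (forall W, dots X W = dots Y W) -> X = Y.
Proof.
move=> XY; apply: sT_eq.
- apply: dotvP => U; have := XY (inV U); rewrite !dotsE /inV !partE !dotz0r !mulr0 !addr0;
    exact.
- apply: dotzP => U; have := XY (inZ U); rewrite !dotsE /inZ !partE !dotv0r !mulr0 !addr0
    !add0r; exact.
- have := XY (vecA G); rewrite ![dots _ (vecA G)]dotsC !dots_vecA; exact.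
Qed.

Lemma zspace_dim_gt0 : (0 < \dim (zspace G))%N.
Proof.
have [x [y xy]] := lie_neq0 G; rewrite lt0n dimv_eq0; apply: contra xy => /eqP z0.
by rewrite -memv0 -z0; apply/mem_zspaceP => w; exact: lie_nil.
Qed.

(** A vector x that is not central differs from its projection to the center, which is
    the vector representing <x, .> there; the difference is orthogonal to the center. *)
Lemma vspc_dim_gt0 : (0 < \dim (vspc G))%N.
Proof.
have [x [y xy]] := lie_neq0 G; rewrite lt0n dimv_eq0; apply: contra xy => /eqP v0.
(* The Riesz vector of this form on s has the projection of x as its part in z. *)
pose phi (X : sT G) : R := dotn G x (vsval (zpart X)).
have lphi : linear (phi : sT G -> R^o).
  by move=> a X Y; rewrite /phi sT_partD [vsval _]linearP linearPr.
pose phiL : {linear sT G -> R^o} :=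
  HB.pack (phi : sT G -> R^o) (GRing.isLinear.Build R (sT G) R^o *:%R phi lphi).
have [W hW] := riesz (dotS G) phiL.
have : x - vsval (zpart W) \in vspc G.
  apply/mem_orthovP => z zz.
  have := hW (inZ (vsproj (zspace G) z)).
  rewrite -[phiL _]/(dotn G x (vsval (vsproj (zspace G) z))) [dotS _ _ _]dotsE.
  rewrite /inZ !partE dotv0r mulr0 addr0 add0r /dotz vsprojK // => e.
  by rewrite linearBl /= e subrr.
rewrite v0 memv0 subr_eq0 => /eqP ->.
by have /mem_zspaceP -> := subvsP (zpart W).
Qed.

Lemma dim_sT : \dim {:sT G} = (\dim (vspc G) + (1 + \dim (zspace G)))%N.
Proof. by rewrite dimvf /dim /= -addnA [(_ + 1)%N]addnC. Qed.

Lemma dots_linear X : linear (dots X : sT G -> R^o).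
Proof. by move=> a u w; rewrite dotsDr dotsZr. Qed.
Definition dots_form X : {linear sT G -> R^o} :=
  HB.pack (dots X : sT G -> R^o) (GRing.isLinear.Build R (sT G) R^o *:%R (dots X)
      (dots_linear X)).

(** The normal form with w the gradient and e a map from z to the orthogonal complement
    of w. In the applications e is a similarity and es a multiple of its adjoint, so that
    e (es X) is the orthogonal projection of X to the image of e. *)
Lemma full_spectrum (H : 'End(sT G)) (w : sT G) (e : zT G -> sT G) (es : sT G -> zT G) :
  linear e -> linear es ->
  dots w w = 1 -> (forall y, dots w (e y) = 0) ->
  es w = 0 -> (forall y, es (e y) = y) ->
  (forall X W, dots (H X) W = (dots X W - dots w X * dots w W + dots (e (es X)) W) / 2) ->
  has_spectrum H fullv
    [:: (0, 1%N); (1 / 2, \dim (vspc G)); (1, \dim (zspace G))].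
Proof.
move=> le les ww we esw ese hH.
pose eL : {linear zT G -> sT G} :=
  HB.pack e (GRing.isLinear.Build R (zT G) (sT G) *:%R e le).
pose esL : {linear sT G -> zT G} :=
  HB.pack es (GRing.isLinear.Build R (sT G) (zT G) *:%R es les).
apply: (@split_spectrum R (sT G) (zT G) H fullv (dots_form w) w eL esL) => //.
- by rewrite memvf.
- by move=> y; rewrite memvf.
- move=> X _; apply: dotsP => W.
  by rewrite hH dotsZl dotsDl dotsDl dotsNl dotsZl mulrC mul1r.
- exact: vspc_dim_gt0.
- exact: zspace_dim_gt0.
- exact: dim_sT.
Qed.

Lemma spectrum_oo (H : 'End(sT G)) : (forall X Y, dots (H X) Y = hess_oo X Y) ->
  has_spectrum H fullv
    [:: (0, 1%N); (1 / 2, \dim (vspc G)); (1, \dim (zspace G))].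
Proof.
move=> hH; apply: (@full_spectrum H (vecA G) (@inZ _ _ _) (@zpart _ _ _)) => //.
- by move=> a u w; apply: sT_eq; rewrite /inZ !sT_partD !partE ?scaler0 ?mulr0 ?addr0 //.
- by rewrite dots_vecA.
- by move=> y; rewrite dots_vecA.
- by move=> X W; rewrite hH /hess_oo !dots_vecA !dotsE /inZ !partE dotv0l; field.
Qed.

(** When Z = 0 each unit Y in z spans with V, J_Y V and A a complex hyperbolic plane that
    contains the gradient; e Y is, up to sign and to the norm busE, the image of the gradient
    under its complex structure, an eigenvector for 1. *)
Lemma spectrum_Z0 x (H : 'End(sT G)) : 0 < apart x -> zpart x = 0 ->
  (forall X Y, dots (H X) Y = hess_bus J x X Y) ->
  has_spectrum H fullv
    [:: (0, 1%N); (1 / 2, \dim (vspc G)); (1, \dim (zspace G))].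
Proof.
move=> x0 Z0 hH.
have F0 := lt0r_neq0 (busF_gt0 x0); have E0 := lt0r_neq0 (busE_gt0 x0).
pose s := Num.sqrt (apart x); have sE : s ^+ 2 = apart x by rewrite sqr_sqrtr // ltW.
have FE : busF x = busE x ^+ 2 by rewrite /busF Z0 dotz0l addr0.
have VV : dotv (vpart x) (vpart x) = 4 * (busE x - s ^+ 2) by rewrite sE /busE; field.
pose e (y : zT G) : sT G := (s *: J y (vpart x), (busE x - 2 * apart x) *: y, 0).
pose es (X : sT G) : zT G :=
  (busE x ^+ 2)^-1 *: (s *: brvz (vpart x) (vpart X) + (busE x - 2 * apart x) *: zpart X).
apply: (@full_spectrum H (grad_bus J x) e es).
- move=> a u w; apply: sT_eq; rewrite /e !sT_partD !partE ?mulr0 ?addr0 //.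
    by apply: dotvP => W; rewrite !(JE hJ) !dotvE; ring.
  by apply: dotzP => W; rewrite !dotzE; ring.
- move=> a u w; apply: dotzP => W; rewrite /es !sT_partD !brvzE !dotzE; ring.
- exact: grad_bus_unit.
- move=> y; rewrite dots_grad_bus // /dbusF /e !partE Z0 !brvzE !dotvE !dotzE (dotvJr hJ)
    brvz_alt !dotzE.
  by ring.
- apply: dotzP => W; rewrite /es /grad_bus -[vpart (_ - _)]/((busF x)^-1 *: vpart (grad_busF
    J x) - vpart (vecA G)).
  rewrite -[zpart (_ - _)]/((busF x)^-1 *: zpart (grad_busF J x) - zpart (vecA G))
      /grad_busF /vecA !partE Z0.
  by rewrite !(JE hJ) !brvzE brvz_alt !dotzE; ring.
- move=> y; apply: dotzP => W; rewrite /es /e !partE !brvzE (brvzJ hJ) !dotzE VV -sE.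
  by field.
- move=> X W; rewrite hH !dots_grad_bus // /hess_bus /hess_busF /hess_oo /dbusF FE dotsE
    dotsE /e /es !partE Z0.
  rewrite !(JE hJ) !brvzE !dotvE !dotzE !(dotvJl hJ) ?dotzE -/s -sE.
  by rewrite [dotz (brvz (vpart x) (vpart X)) (zpart W)]dotzC; field.
Qed.

(** When V = 0 the gradient lies in z + R A. The map e is the restriction to z of the
    reflection that exchanges - A and the gradient. *)
Lemma spectrum_V0 x (H : 'End(sT G)) : 0 < apart x -> vpart x = 0 ->
  (forall X Y, dots (H X) Y = hess_bus J x X Y) ->
  has_spectrum H fullv
    [:: (0, 1%N); (1 / 2, \dim (vspc G)); (1, \dim (zspace G))].
Proof.
move=> x0 V0 hH.
have F0 := lt0r_neq0 (busF_gt0 x0).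
have EE : busE x = apart x by rewrite /busE V0 dotv0l mul0r addr0.
have ZZ : dotz (zpart x) (zpart x) = busF x - apart x ^+ 2 by rewrite /busF EE; ring.
pose e (y : zT G) : sT G :=
  (0, y - (2 * dotz (zpart x) y / busF x) *: zpart x, 2 * apart x * dotz (zpart x) y / busF x).
pose es (X : sT G) : zT G :=
  zpart X + (2 * (apart x * apart X - dotz (zpart x) (zpart X)) / busF x) *: zpart x.
apply: (@full_spectrum H (grad_bus J x) e es).
- move=> a u w; apply: sT_eq; rewrite /e !sT_partD !partE ?scaler0 ?addr0 //.
    by apply: dotzP => W; rewrite !dotzE; field.
  by rewrite !dotzE; field.
- by move=> a u w; apply: dotzP => W; rewrite /es !sT_partD !dotzE; field.
- exact: grad_bus_unit.
- move=> y; rewrite dots_grad_bus // /dbusF /e !partE V0 !brvzE !dotvE !dotzE ZZ EE.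
  by field.
- apply: dotzP => W; rewrite /es /grad_bus.
  rewrite -[apart (_ - _)]/((busF x)^-1 * apart (grad_busF J x) - apart (vecA G)).
  rewrite -[zpart (_ - _)]/((busF x)^-1 *: zpart (grad_busF J x) - zpart (vecA G))
      /grad_busF /vecA !partE.
  by rewrite !dotzE ZZ EE; field.
- by move=> y; apply: dotzP => W; rewrite /es /e !partE !dotzE ZZ; field.
- move=> X W; rewrite hH !dots_grad_bus // /hess_bus /hess_busF /hess_oo /dbusF EE dotsE
    dotsE /e /es !partE V0.
  rewrite !brvzE (J0r hJ) !brvzE !dotvE !dotzE ZZ.
  by field.
Qed.

End HessianSpectrum.

(** * The spectrum on the span of V, J_Z V, Z and A *)

Section S4.
Variables (R : realType) (n : vectType R) (G : metricLie2 n).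
Variables (J : zT G -> vT G -> vT G) (hJ : generalized_heisenberg J).
Implicit Types (X Y W : sT G).
Variables (V : vT G) (Z : zT G) (V0 : V != 0) (Z0 : Z != 0).

Definition s4_comb (c1 c2 c3 c4 : R) : sT G := (c1 *: V + c2 *: J Z V, c3 *: Z, c4).

Lemma s4_combE c1 c2 c3 c4 : s4_comb c1 c2 c3 c4 =
  c1 *: inV V + (c2 *: inV (J Z V) + (c3 *: inZ Z + c4 *: vecA G)).
Proof.
apply: sT_eq; rewrite /s4_comb /inV /inZ /vecA ?sT_partD partE.
- rewrite -[RHS]/(c1 *: V + (c2 *: J Z V + (c3 *: 0 + c4 *: 0))).
  by rewrite !scaler0 !addr0.
- rewrite -[RHS]/(c1 *: 0 + (c2 *: 0 + (c3 *: Z + c4 *: 0))).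
  by rewrite !scaler0 !addr0 !add0r.
- rewrite -[RHS]/(c1 * 0 + (c2 * 0 + (c3 * 0 + c4 * 1))).
  by rewrite !mulr0 !add0r mulr1.
Qed.

Lemma mem_s4P X : reflect (exists c1 c2 c3 c4, X = s4_comb c1 c2 c3 c4) (X \in s4 J V Z).
Proof.
apply: (iffP idP) => [|[c1 [c2 [c3 [c4 ->]]]]].
  rewrite /s4 span_cons => /memv_addP[_ /vlineP[c1 ->] [u + ->]].
  rewrite span_cons => /memv_addP[_ /vlineP[c2 ->] [u' + ->]].
  rewrite span_cons => /memv_addP[_ /vlineP[c3 ->] [u'' + ->]].
  rewrite span_seq1 => /vlineP[c4 ->].
  by exists c1, c2, c3, c4; rewrite s4_combE.
by rewrite s4_combE !rpredD // rpredZ // memv_span // !inE eqxx ?orbT.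
Qed.

(** This is how the four generators of s4 are shown to be independent: each is
    orthogonal to the following ones. *)
Lemma notin_span_orthogonal (w : sT G) (us : seq (sT G)) :
  w != 0 -> (forall u, u \in us -> dots u w = 0) -> w \notin <<us>>%VS.
Proof.
move=> w0 h; apply: contra_neqN w0 => wu.
have : w \in orthov (dotS G) <[w]>.
  apply: (subvP _ _ wu); apply/span_subvP => u uu.
  by rewrite mem_orthov1; apply/eqP; exact: h.
rewrite mem_orthov1 => /eqP ww; apply/eqP; apply: contraTT isT => w0.
by have := dots_gt0 w0; rewrite ww ltxx.
Qed.

Lemma s4_free : free [:: inV V; inV (J Z V); inZ Z; vecA G].
Proof.
have JV0 : J Z V != 0.
  apply: contra_neq V0 => e; apply: dotv_eq0; apply/eqP.
  have := dotvJJ hJ Z V V; rewrite e dotv0l => /esym/eqP; rewrite mulf_eq0.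
  by rewrite (gt_eqF (dotz_gt0 Z0)).
rewrite !free_cons nil_free andbT; apply/and4P; split.
- apply: notin_span_orthogonal; first by apply: contra_neq V0 => -[].
  move=> u; rewrite !inE => /or3P[]/eqP ->; rewrite dotsE /inV /inZ /vecA !partE.
  + by rewrite (dotvJl hJ) brvz_alt !dotz0r mul0r !addr0.
  + by rewrite dotv0l dotz0r mul0r !addr0.
  + by rewrite dotv0l dotz0r mulr0 !addr0.
- apply: notin_span_orthogonal; first by apply: contra_neq JV0 => -[].
  move=> u; rewrite !inE => /orP[]/eqP ->; rewrite dotsE /inV /inZ /vecA !partE.
  + by rewrite dotv0l dotz0r mul0r !addr0.
  + by rewrite dotv0l dotz0r mulr0 !addr0.
- apply: notin_span_orthogonal; first by apply: contra_neq Z0 => -[].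
  move=> u; rewrite !inE => /eqP ->; rewrite dotsE /inV /inZ /vecA !partE.
  by rewrite dotv0l dotz0l mulr0 !addr0.
- rewrite span_nil memv0; apply/eqP => /(congr1 (@apart _ _ _)).
  by rewrite /vecA partE; apply/eqP; rewrite oner_eq0.
Qed.

Lemma s4_dim : \dim (s4 J V Z) = 4%N.
Proof. by have := s4_free; rewrite /free => /eqP. Qed.

Variables (a : R) (a0 : 0 < a).
Let x : sT G := (V, Z, a).
Variables (H : 'End(sT G)) (hH : forall X Y, dots (H X) Y = hess_bus J x X Y).

Let xE : (vpart x = V) * (zpart x = Z) * (apart x = a). Proof. by []. Qed.
Let s := Num.sqrt a.
Let sE : s ^+ 2 = a. Proof. by rewrite sqr_sqrtr // ltW. Qed.
Let F0 : busF x != 0. Proof. by rewrite lt0r_neq0 // busF_gt0. Qed.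
Let nuE : dotv V V = 4 * (busE x - a). Proof. by rewrite /busE /x !partE; field. Qed.
Let zzE : dotz Z Z = busF x - busE x ^+ 2. Proof. by rewrite /busF /x !partE; ring. Qed.
Let zz0 : dotz Z Z != 0. Proof. by rewrite gt_eqF // dotz_gt0. Qed.

Let Jgrad : sT G := s4_comb (s * dotz Z Z) (s * busE x) (busF x - 2 * a * busE x) (- 2 * a *
    dotz Z Z).

Lemma grad_bus_s4 : grad_bus J x = s4_comb (- s * busE x / busF x) (s / busF x) (- 2 * a /
    busF x)
  (2 * a * busE x / busF x - 1).
Proof.
apply: dotsP => W; rewrite dots_grad_bus // dotsE /s4_comb /dbusF.
move: F0; set F := busF x; set E := busE x; clearbody F E => F1; rewrite !xE !partE !dotvE
    !dotzE (dotvJl hJ) -/s -sE.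
by field.
Qed.

Let Jbr W : dotz Z (brvz (J Z V) (vpart W)) = - dotz Z Z * dotv V (vpart W).
Proof. by rewrite -(dotvJl hJ) (JJ hJ) dotvE. Qed.

(** The span is the tangent space of a complex hyperbolic plane, whose horospheres have
    principal curvatures 1 in the direction of the rotated gradient and 1 / 2 in the two
    directions orthogonal to it. The vector Jgrad is the image of the gradient under the
    complex structure, times - |Z| F. *)
Lemma spectrum_s4 : has_spectrum H (s4 J V Z) [:: (0, 1%N); (1 / 2, 2%N); (1, 1%N)].
Proof.
pose e (y : R) : sT G := y *: Jgrad.
pose es (X : sT G) : R := dots Jgrad X / (dotz Z Z * busF x ^+ 2).
have le : linear (e : R^o -> sT G).
  by move=> c u w; rewrite /e scalerDl -scalerA.
have les : linear (es : sT G -> R^o).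
  by move=> c u w; rewrite /es dotsDr dotsZr mulrDl -mulrA.
pose eL : {linear R^o -> sT G} :=
  HB.pack (e : R^o -> sT G) (GRing.isLinear.Build R R^o (sT G) *:%R e le).
pose esL : {linear sT G -> R^o} :=
  HB.pack (es : sT G -> R^o) (GRing.isLinear.Build R (sT G) R^o *:%R es les).
have w4w4 : dots Jgrad Jgrad = dotz Z Z * busF x ^+ 2.
  rewrite dotsE /Jgrad /s4_comb !partE !dotvE !dotzE (dotvJJ hJ) !(dotvJl hJ, dotvJr hJ).
  rewrite brvz_alt !dotzE nuE -sE zzE; ring.
have gw4 : dots (grad_bus J x) Jgrad = 0.
  rewrite grad_bus_s4 dotsE /Jgrad /s4_comb !partE !dotvE !dotzE (dotvJJ hJ) !(dotvJl hJ,
      dotvJr hJ).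
  by rewrite brvz_alt !dotzE nuE -sE zzE; field.
apply: (@split_spectrum R (sT G) R^o H (s4 J V Z) (dots_form (grad_bus J x)) (grad_bus J x)
    eL esL) => //.
- by apply/mem_s4P; rewrite grad_bus_s4; do 4 eexists.
- by move=> y; rewrite rpredZ //; apply/mem_s4P; do 4 eexists.
- exact: grad_bus_unit.
- by move=> y; rewrite -[LHS]/(dots (grad_bus J x) (y *: Jgrad)) dotsZr gw4 mulr0.
- by rewrite -[LHS]/(dots Jgrad (grad_bus J x) / _) dotsC gw4 mul0r.
- move=> y; rewrite -[LHS]/(dots Jgrad (y *: Jgrad) / _) dotsZr w4w4 -mulrA divff ?mulr1 //.
  by rewrite mulf_neq0 // expf_neq0.
- move=> X /mem_s4P[c1 [c2 [c3 [c4 ->]]]]; apply: dotsP => W.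
  rewrite hH dotsZl dotsDl dotsDl dotsNl dotsZl.
  rewrite -[dots_form _ _]/(dots (grad_bus J x) (s4_comb c1 c2 c3 c4)).
  rewrite -[eL _]/((dots Jgrad (s4_comb c1 c2 c3 c4) / (dotz Z Z * busF x ^+ 2)) *: Jgrad)
      dotsZl.
  rewrite /Jgrad /hess_bus /hess_oo /hess_busF /dbusF !dots_grad_bus // /dbusF.
  move: F0 zz0 nuE zzE; set F := busF x; set E := busE x; clearbody F E => F1 zz1 nuE' zzE'.
  rewrite !dotsE /s4_comb !xE !partE.
  rewrite !brvzE !brvz_alt (brvzJ hJ) [brvz (J Z V) V]brvzC (brvzJ hJ).
  rewrite !dotvE !dotzE !Jbr (dotvJJ hJ) !(dotvJl hJ, dotvJr hJ) !brvz_alt.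
  rewrite !dotzE -/s nuE' -sE; move: zz1; rewrite zzE' => zz1.
  by rewrite [dotz (zpart W) Z]dotzC; field; rewrite F1 zz1.
- by rewrite s4_dim.
Qed.

(** H is symmetric and preserves s4. *)
Lemma s4perp_stable : (H @: s4perp J V Z <= s4perp J V Z)%VS.
Proof.
have [s4st _ _] := spectrum_s4.
apply/subvP => _ /memv_imgP[X /mem_orthovP Xp ->]; apply/mem_orthovP => Y Y4.
rewrite -[LHS]/(dots (H X) Y) hH hess_busC -hH dotsC.
by apply: Xp; rewrite (subvP s4st) // memv_img.
Qed.

Lemma mem_s4perp X : X \in s4perp J V Z ->
  [/\ apart X = 0, dotz Z (zpart X) = 0, dotv V (vpart X) = 0 &
      dotz Z (brvz V (vpart X)) = 0].
Proof.
move=> /mem_orthovP h.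
have g Y : Y \in [:: inV V; inV (J Z V); inZ Z; vecA G] -> dots Y X = 0.
  by move=> Yi; rewrite dotsC h // memv_span.
split.
- by have := g (vecA G); rewrite dots_vecA; apply; rewrite !inE eqxx !orbT.
- have := g (inZ Z); rewrite dotsE /inZ !partE dotv0l mul0r add0r addr0.
  by apply; rewrite !inE eqxx !orbT.
- have := g (inV V); rewrite dotsE /inV !partE dotz0l mul0r !addr0.
  by apply; rewrite !inE eqxx.
- have := g (inV (J Z V)); rewrite dotsE /inV !partE dotz0l mul0r !addr0 (dotvJl hJ).
  by apply; rewrite !inE eqxx !orbT.
Qed.

End S4.

(** * The cubic equation on the orthogonal complement *)

Section S4perp.
Variables (R : realType) (n : vectType R) (G : metricLie2 n).
Variables (J : zT G -> vT G -> vT G) (hJ : generalized_heisenberg J).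
Implicit Types (X Y W : sT G).
Variables (V : vT G) (Z : zT G) (V0 : V != 0) (Z0 : Z != 0).

(** The operator K without the normalisation of V and Z: it is |V|^2 |Z| K. *)
Definition unscaledK (Y : zT G) : zT G := brvz V (J Y (J Z V)).

Lemma unscaledKZ (c : R) (Y : zT G) : unscaledK (c *: Y) = c *: unscaledK Y.
Proof. by rewrite /unscaledK (JZl hJ) brvzZr. Qed.

(** The sum of the two sides is, by polarisation, a multiple of <V, J_Z V> = 0. *)
Lemma unscaledK_skew (Y T : zT G) : dotz Y (unscaledK T) = - dotz T (unscaledK Y).
Proof.
rewrite /unscaledK -!(dotvJl hJ).
have := dotvJJ_polar hJ Y T V (J Z V).
have -> : dotv V (J Z V) = 0 by rewrite (dotvJr hJ) brvz_alt dotz0r.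
by rewrite mulr0 => /eqP; rewrite addr_eq0 => /eqP.
Qed.

Lemma Kop_unscaled (Y : zT G) : Kop J ((normv V)^-1 *: V) ((normz Z)^-1 *: Z) Y
  = (normv V ^- 2 * (normz Z)^-1) *: unscaledK Y.
Proof.
apply: dotzP => T; rewrite /Kop /unscaledK !(JE hJ) !brvzE !dotzE -exprVn; ring.
Qed.

Variables (a : R) (a0 : 0 < a).
Let x : sT G := (V, Z, a).
Variables (H : 'End(sT G)) (hH : forall X Y, dots (H X) Y = hess_bus J x X Y).

Let s := Num.sqrt a.
Let sE : s ^+ 2 = a. Proof. by rewrite sqr_sqrtr // ltW. Qed.
Let F := busF x.
Let F0 : F != 0. Proof. by rewrite lt0r_neq0 // busF_gt0. Qed.
Let nu := dotv V V.
Let zz := dotz Z Z.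
Let nu0 : nu != 0. Proof. by rewrite gt_eqF // dotv_gt0. Qed.
Let zz0 : zz != 0. Proof. by rewrite gt_eqF // dotz_gt0. Qed.
Let E := busE x.
Let EE : E = a + nu / 4. Proof. by []. Qed.
Let FE : F = E ^+ 2 + zz. Proof. by []. Qed.
Let c := E / 2 - a.

(** The gradient lies in s4, so the rank one term vanishes, and so do all terms with
    a component along A. *)
Lemma hess_bus_s4perp X W : X \in s4perp J V Z -> apart W = 0 ->
  hess_bus J x X W =
  (s * c * (dotz (zpart X) (brvz V (vpart W)) + dotz (zpart W) (brvz V (vpart X)))
   - s / 2 * (dotz (zpart X) (brvz (J Z V) (vpart W)) + dotz (zpart W) (brvz (J Z V) (vpart X)))
   + a / 2 * dotz (brvz V (vpart X)) (brvz V (vpart W))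
   + 2 * a * (a - E) * dotz (zpart X) (zpart W)) / F
  + dotv (vpart X) (vpart W) / 2 + dotz (zpart X) (zpart W).
Proof.
move=> /(mem_s4perp hJ)[Xa Xz Xv Xb] Wa.
have xE : (vpart x = V) * (zpart x = Z) * (apart x = a) by [].
rewrite /hess_bus /hess_oo /hess_busF /dbusF !xE Xa Xz Xv Xb Wa -/s -/E -/F /c.
by field.
Qed.

Variables (lam : R) (X : sT G).
Hypotheses (Xp : X \in s4perp J V Z) (HX : H X = lam *: X).
Let xi := vpart X.
Let y := zpart X.
Let u := brvz V xi.
Let q := brvz (J Z V) xi.
Let l := lam - 1 / 2.
Let rho := a * nu / (2 * F).

Let test W : apart W = 0 ->
  lam * (dotv xi (vpart W) + dotz y (zpart W)) = hess_bus J x X W.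
Proof.
move=> Wa; rewrite -hH HX dotsZl dotsE Wa mulr0 addr0 //.
Qed.

Let eqV (U : vT G) : l * dotv xi U = s * c / F * dotz y (brvz V U)
  - s / (2 * F) * dotz y (brvz (J Z V) U) + a / (2 * F) * dotz u (brvz V U).
Proof.
have := test (W := inV U) erefl; rewrite hess_bus_s4perp // /inV !partE !dotz0l !dotz0r.
rewrite -/y -/xi -/u -/q /l => e.
rewrite mulrBl; move: e; rewrite addr0 => ->.
by field.
Qed.

Let eqY (T : zT G) : (l - 1 / 2 + rho) * dotz y T = s / F * (c * dotz u T - dotz q T / 2).
Proof.
have := test (W := inZ T) erefl; rewrite hess_bus_s4perp // /inZ !partE !brvz0r !dotz0r dotv0r.
rewrite -/y -/xi -/u -/q ![dotz T _]dotzC add0r => e.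
have -> : (l - 1 / 2 + rho) * dotz y T = lam * dotz y T - (1 - rho) * dotz y T.
  by rewrite /l; field.
by rewrite e /rho EE; field.
Qed.

Let eqU (T : zT G) : (l - rho) * dotz u T = s / F * (c * nu * dotz y T - dotz (unscaledK y)
    T / 2).
Proof.
have := eqV (J T V); rewrite (dotvJr hJ) -/u (brvzJ hJ) (dotz_brvzJ hJ).
rewrite brvzC -/(unscaledK y) !dotzE -/nu [dotz T u]dotzC [dotz T _]dotzC => e.
by rewrite mulrBl e /rho; field.
Qed.

Let eqQ (T : zT G) : l * dotz q T =
  s / F * (- c * dotz (unscaledK y) T - nu * zz / 2 * dotz y T) - a / (2 * F) * dotz
      (unscaledK u) T.
Proof.
have := eqV (J T (J Z V)); rewrite (dotvJr hJ) -/q (brvzJ hJ) (dotvJJ hJ) -/nu -/zz.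
rewrite -/(unscaledK T) ![dotz _ (unscaledK T)]unscaledK_skew !dotzE ![dotz T _]dotzC => ->.
by field.
Qed.

Let eqKU (T : zT G) : (l - rho) * dotz (unscaledK u) T =
  s / F * (c * nu * dotz (unscaledK y) T - dotz (unscaledK (unscaledK y)) T / 2).
Proof.
have := eqU (unscaledK T); rewrite ![dotz _ (unscaledK T)]unscaledK_skew ![dotz T _]dotzC => e.
by apply: oppr_inj; rewrite -mulrN e; field.
Qed.

(** Let y and xi be the components of the eigenvector in z and v, u = [V, xi] and
    q = [J_Z V, xi]. Pairing the eigenvalue equation with z, with the J_T V and with the
    J_T J_Z V gives three equations between y, u and q. Eliminating u and q leaves y alone
    with K^2 y, without division by a factor that could vanish. *)
Lemma cubic_of_zpart_neq0 : y != 0 -> exists k, unscaledK (unscaledK y) = (nu ^+ 2 * zz * k)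
    *: y /\
  l ^+ 2 * (l - 1 / 2) = - (k + 1) * (a ^+ 2 * nu ^+ 2 * zz) / (8 * F ^+ 3).
Proof.
move=> y0.
(* A is what multiplies y after the elimination. *)
pose A := l * (l - rho) * (l - 1 / 2 + rho)
  - a / F ^+ 2 * nu * (c ^+ 2 * l + (l - rho) * zz / 4).
have main T : A * dotz y T = - (a ^+ 2 / (8 * F ^+ 3)) * dotz (unscaledK (unscaledK y)) T.
  have -> : A * dotz y T = l * (l - rho) * ((l - 1 / 2 + rho) * dotz y T)
     - a / F ^+ 2 * nu * (c ^+ 2 * l + (l - rho) * zz / 4) * dotz y T.
    by rewrite /A; ring.
  rewrite eqY.
  have -> : l * (l - rho) * (s / F * (c * dotz u T - dotz q T / 2))
     = s / F * (c * l * ((l - rho) * dotz u T) - (l - rho) / 2 * (l * dotz q T)) by field.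
  rewrite eqU eqQ.
  have -> : (l - rho) / 2 * (s / F * (- c * dotz (unscaledK y) T - nu * zz / 2 * dotz y T)
         - a / (2 * F) * dotz (unscaledK u) T)
     = (l - rho) / 2 * (s / F * (- c * dotz (unscaledK y) T - nu * zz / 2 * dotz y T))
      - a / (4 * F) * ((l - rho) * dotz (unscaledK u) T) by field.
  by rewrite eqKU /rho -sE; field.
pose k := - (A * (8 * F ^+ 3) / (a ^+ 2 * nu ^+ 2 * zz)).
have an0 : a != 0 by rewrite gt_eqF.
exists k; split.
  apply: dotzP => T; rewrite dotzE.
  have -> : nu ^+ 2 * zz * k * dotz y T = - (8 * F ^+ 3 / a ^+ 2) * (A * dotz y T).
    by rewrite /k; field; rewrite an0 nu0 zz0.
  by rewrite main; field; rewrite an0 F0.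
rewrite /k /A /c /rho.
have -> : zz = F - E ^+ 2 by rewrite FE; ring.
have -> : nu = 4 * (E - a) by rewrite EE; field.
have nuE : nu = 4 * (E - a) by rewrite EE; field.
have z1 : F - E ^+ 2 != 0 by rewrite FE addrAC subrr add0r.
have n1 : E - a != 0 by apply: contra_neq nu0 => e; rewrite nuE e mulr0.
by field; rewrite z1 F0 an0 n1.
Qed.

(** Without component in z the equations say that q = 2 c u and that l xi is proportional
    to J_u V. Either u = 0, and xi is orthogonal to all J_T V and J_T J_Z V, or u takes over
    the role of y as an eigenvector of K^2. *)
Lemma cubic_of_zpart_eq0 : X != 0 -> y = 0 ->
  (exists k w, [/\ w != 0, dotz Z w = 0, unscaledK (unscaledK w) = (nu ^+ 2 * zz * k) *: w &
    l ^+ 2 * (l - 1 / 2) = - (k + 1) * (a ^+ 2 * nu ^+ 2 * zz) / (8 * F ^+ 3)])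
  \/ (lam = 1 / 2 /\ has_K_free_vector J V Z).
Proof.
move=> X0 y0.
have [Xa Xz Xv Xb] := mem_s4perp hJ Xp.
have an0 : a != 0 by rewrite gt_eqF.
have s0 : s != 0 by rewrite sqrtr_eq0 -ltNge.
have xi0 : xi != 0.
  apply: contra_neq X0 => xi0; apply: sT_eq => //.
have qE : q = (2 * c) *: u.
  apply: dotzP => T; have /eqP := eqY T.
  rewrite y0 dotz0l mulr0 eq_sym mulf_eq0 mulf_eq0 invr_eq0 (negPf s0) (negPf F0) /= dotzE.
  by move=> /eqP; lra.
have [l0|l0] := eqVneq l 0.
  have u0 : u = 0.
    apply: dotz_eq0; have /eqP := eqU u.
    rewrite y0 l0 /unscaledK (J0l hJ) brvz0r !dotz0l !(mulr0, mul0r) subr0 mulr0 sub0r mulNr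
        oppr_eq0.
    rewrite !mulf_eq0 invr_eq0 mulf_eq0 (negPf an0) (negPf nu0) (negPf F0) pnatr_eq0 /=.
    by move=> /eqP.
  right; split; first by move: l0; rewrite /l; lra.
  exists xi => // T; rewrite !(dotvJr hJ) -/u -/q qE u0 scaler0 dotz0r.
  by split.
left.
have u0 : u != 0.
  apply: contra_neq xi0 => u0; apply: dotv_eq0; apply/eqP.
  have /eqP := eqV xi; rewrite y0 u0 !dotz0l !mulr0 subr0 addr0 mulf_eq0 (negPf l0).
  by [].
have lr : l = rho.
  have /eqP := eqU u; rewrite y0 /unscaledK (J0l hJ) brvz0r !dotz0l !(mulr0, mul0r) subr0
      mulr0 mulf_eq0.
  by rewrite (gt_eqF (dotz_gt0 u0)) orbF subr_eq0 => /eqP.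
have kapu : unscaledK u = - (2 * nu * c) *: u.
  apply: dotzP => T; have := eqQ T.
  rewrite y0 {1}/unscaledK (J0l hJ) brvz0r !dotz0l !mulr0 subr0 mulr0 sub0r qE !dotzE lr => e.
  have -> : dotz (unscaledK u) T = - (2 * F / a) * - (a / (2 * F) * dotz (unscaledK u) T).
    by field; rewrite an0 F0.
  by rewrite -e /rho; field; rewrite an0 F0.
(* The operator K acts on u by a real scalar, whose square is the eigenvalue of K^2. *)
exists (4 * c ^+ 2 / zz), u; split => //.
  rewrite kapu unscaledKZ kapu scalerA; congr (_ *: _).
  by field.
rewrite lr /rho /c.
have -> : zz = F - E ^+ 2 by rewrite FE; ring.
have -> : nu = 4 * (E - a) by rewrite EE; field.
have z1 : F - E ^+ 2 != 0 by rewrite FE addrAC subrr add0r.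
by field; rewrite z1 F0.
Qed.

Lemma s4perp_cubic : X != 0 ->
  (exists k w, [/\ w != 0, dotz Z w = 0, unscaledK (unscaledK w) = (nu ^+ 2 * zz * k) *: w &
    l ^+ 2 * (l - 1 / 2) = - (k + 1) * (a ^+ 2 * nu ^+ 2 * zz) / (8 * F ^+ 3)])
  \/ (lam = 1 / 2 /\ has_K_free_vector J V Z).
Proof.
move=> X0; have [y0|y0] := eqVneq y 0; first exact: cubic_of_zpart_eq0.
have [k [h1 h2]] := cubic_of_zpart_neq0 y0; left; exists k, y; split => //.
by case: (mem_s4perp hJ Xp).
Qed.

(** A skew-symmetric operator has a nonpositive square. *)
Lemma unscaledK2_le0 k (w : zT G) : w != 0 -> unscaledK (unscaledK w) = (nu ^+ 2 * zz * k)
    *: w -> k <= 0.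
Proof.
move=> w0 hk.
have := dotz_ge0 (unscaledK w); rewrite unscaledK_skew hk dotzE.
have w1 := dotz_gt0 w0.
have p0 : 0 < nu ^+ 2 * zz * dotz w w.
  by rewrite !mulr_gt0 // ?exprn_gt0 // ?dotv_gt0 // ?dotz_gt0.
rewrite mulrAC oppr_ge0 => h.
by move: h; rewrite pmulr_rle0.
Qed.

(** If lam <= 0, the left-hand side is at most - 1 / 4. The right-hand side is at least
    - a^2 |V|^4 |Z|^2 / (8 F^3) as k <= 0, and this is larger than - 1 / 4 because
    F >= a |V|^2 + |Z|^2. *)
Lemma cubic_pos k : k <= 0 ->
  l ^+ 2 * (l - 1 / 2) = - (k + 1) * (a ^+ 2 * nu ^+ 2 * zz) / (8 * F ^+ 3) -> 0 < lam.
Proof.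
move=> k0 e; rewrite ltNge; apply/negP => lam0.
have nup : 0 < nu by rewrite dotv_gt0.
have zzp : 0 < zz by rewrite dotz_gt0.
have Fp : 0 < F by exact: busF_gt0.
pose A := a * nu.
have Ap : 0 < A by rewrite mulr_gt0.
have FA : A + zz <= F.
  rewrite FE EE /A lerD2r -subr_ge0.
  have -> : (a + nu / 4) ^+ 2 - a * nu = (a - nu / 4) ^+ 2 by field.
  by rewrite sqr_ge0.
(* The cube of A + zz contains the term 3 A^2 zz and is at most F^3. *)
have F3 : A ^+ 2 * zz < 2 * F ^+ 3.
  have h : (A + zz) ^+ 3 <= F ^+ 3 by rewrite lerXn2r // ?nnegrE ?ltW // addr_gt0.
  have h1 : 0 < A ^+ 2 * zz by rewrite mulr_gt0 // exprn_gt0.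
  have h2 : 0 < A * zz ^+ 2 by rewrite mulr_gt0 // exprn_gt0.
  have h3 : 0 < A ^+ 3 by rewrite exprn_gt0.
  have h4 : 0 < zz ^+ 3 by rewrite exprn_gt0.
  have h5 : (A + zz) ^+ 3 = A ^+ 3 + 3 * (A ^+ 2 * zz) + 3 * (A * zz ^+ 2) + zz ^+ 3 by ring.
  by move: h; rewrite h5; lra.
pose Q := a ^+ 2 * nu ^+ 2 * zz / (8 * F ^+ 3).
have Q4 : Q < 1 / 4.
  rewrite /Q ltr_pdivrMr ?mulr_gt0 ?exprn_gt0 //.
  have -> : a ^+ 2 * nu ^+ 2 * zz = A ^+ 2 * zz by rewrite /A; ring.
  by move: F3; lra.
have Q0 : 0 <= Q by rewrite /Q divr_ge0 // ?mulr_ge0 ?exprn_ge0 // ltW.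
have e2 : l ^+ 2 * (l - 1 / 2) = - (k + 1) * Q by rewrite e /Q; field.
have hl : l <= - (1 / 2) by rewrite /l; lra.
have l2 : 1 / 4 <= l ^+ 2 by nra.
have kQ : k * Q <= 0 by rewrite mulr_le0_ge0.
nra.
Qed.

End S4perp.

(** * The spectra of the Hessians of Busemann functions *)

Theorem theorem1 (R : realType) (n : vectType R) (G : metricLie2 n)
    (J : zT G -> vT G -> vT G) (hJ : generalized_heisenberg J) :
  (forall p : damek_ricci G, exists2 H : 'End(sT G),
     is_hessian (busemann None) p H &
     has_spectrum H fullv
       [:: (0, 1%N); (1 / 2, \dim (vspc G)); (1, \dim (zspace G))])
  /\
  (forall (v : vT G) (z : zT G) (p : damek_ricci G),
     let V := v - cV p in
     let Z := z - cZ p - (1 / 2) *: brvz (cV p) v in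
     let a := (ca p)%:num in
     let F := (a + normv V ^+ 2 / 4) ^+ 2 + normz Z ^+ 2 in
     exists2 H : 'End(sT G),
       is_hessian (busemann (Some (v, z))) p H &
       (V = 0 \/ Z = 0 ->
          has_spectrum H fullv
            [:: (0, 1%N); (1 / 2, \dim (vspc G)); (1, \dim (zspace G))])
       /\
       (V != 0 -> Z != 0 ->
          has_spectrum H (s4 J V Z) [:: (0, 1%N); (1 / 2, 2%N); (1, 1%N)]
          /\
          (H @: s4perp J V Z <= s4perp J V Z)%VS
          /\
          forall lambda : R,
            eigenvalue_on H [set` s4perp J V Z] lambda ->
            0 < lambda /\
            ((exists2 mu : R,
                let K := Kop J ((normv V)^-1 *: V) ((normz Z)^-1 *: Z) in
                eigenvalue_on (K \o K) [set X : zT G | dotz Z X = 0] mu &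
                (lambda - 1 / 2) ^+ 2 * (lambda - 1) =
                  - (mu + 1) * (a ^+ 2 * normv V ^+ 4 * normz Z ^+ 2)
                    / (8 * F ^+ 3))
             \/
             (lambda = 1 / 2 /\ has_K_free_vector J V Z)))).
Proof.
split => [p|v z p V Z a F].
  have [H hH hf] := hessian_oo hJ p.
  by exists H; last exact: spectrum_oo.
have [H hH hf] := hessian_pt hJ v z p.
have a0 : 0 < a by rewrite /a.
exists H => //; split => [VZ|V0 Z0].
  have x0 := relpos_gt0 v z p.
  by case: VZ => h; [exact: spectrum_V0 hf|exact: spectrum_Z0 hf].
have hf' : forall X Y, dots (H X) Y = hess_bus J (V, Z, a) X Y by exact: hf.
split; first exact: (spectrum_s4 hJ V0 Z0 a0 hf').
split; first exact: (s4perp_stable hJ V0 Z0 a0 hf').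
move=> lam [X [Xp X0 HX]].
have FE : F = busF (V, Z, a) by rewrite /busF /busE /F normv_sqr normz_sqr.
have N0 : normv V != 0 by rewrite sqrtr_eq0 -ltNge dotv_gt0.
have M0 : normz Z != 0 by rewrite sqrtr_eq0 -ltNge dotz_gt0.
have [[k [w [w0 Zw kw cub]]]|free] := s4perp_cubic hJ V0 Z0 a0 hf' Xp HX X0; last first.
  by split; [case: free => -> _; lra|right].
have k0 := unscaledK2_le0 hJ V0 Z0 w0 kw.
split; first by have := cubic_pos V0 Z0 a0 k0 cub.
left; exists k.
  exists w; split => //=.
  rewrite !(Kop_unscaled hJ) (unscaledKZ hJ) kw !scalerA -normv_sqr -normz_sqr; congr (_ *: _).
  by field; rewrite N0 M0.
rewrite FE -[normv V ^+ 4]/(normv V ^+ (2 * 2)) exprM normv_sqr normz_sqr -cub.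
by field.
Qed.
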